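(* Let $q$ be a prime power and $n\geq 1$. A weak egg in $\mathrm{PG}(4n-1,q)$ (consisting of $q^{2n}+1$ subspaces of dimension $n-1$) which is good at two distinct elements is elementary.
   Context: $\mathrm{PG}(r,q)$ is the $r$-dimensional projective space over $\mathbb{F}_q$; dimensions are projective. A cap in $\mathrm{PG}(r,q)$ is a set of points such that every three points span a plane. A pseudo-cap in $\mathrm{PG}(4n-1,q)$ is a set of $(n-1)$-spaces such that any three elements span a $(3n-1)$-space. A weak egg in $\mathrm{PG}(4n-1,q)$ is a pseudo-cap of size $q^{2n}+1$. A weak egg $\mathcal{E}$ is good at an element $E\in\mathcal{E}$ if every $(3n-1)$-space containing $E$ and at least two other elements of $\mathcal{E}$ contains exactly $q^n+1$ elements of $\mathcal{E}$. Field reduction: viewing $\mathbb{F}_{q^n}^{r}$ as an $rn$-dimensional $\mathbb{F}_q$-vector space, each point of $\mathrm{PG}(r-1,q^n)$ corresponds to an $(n-1)$-space of $\mathrm{PG}(rn-1,q)$. A pseudo-cap in $\mathrm{PG}(rn-1,q)$ is elementary if it is obtained (up to choice of identification) by field reduction from a cap of $\mathrm{PG}(r-1,q^n)$. *)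

(* Defs.v *)
From HB Require Import structures.
From mathcomp Require Import all_boot all_order all_algebra all_field finmap.

Set Implicit Arguments.
Unset Strict Implicit.
Unset Printing Implicit Defensive.

Import GRing.Theory.
Local Open Scope ring_scope.
Local Open Scope fset_scope.

(* PG(m - 1, q) is modelled by the subspaces of 'rV[F]_m with q = #|F|; a     *)
(* space of projective dimension d is a subspace of vector dimension d + 1.   *)

Definition cap (K : fieldType) (r : nat) (C : {fset {vspace 'rV[K]_r}}) : Prop :=
  (forall P, P \in C -> \dim P = 1%N) /\
  (forall P Q R, P \in C -> Q \in C -> R \in C ->
     uniq [:: P; Q; R] -> \dim (P + Q + R) = 3%N).

Definition pseudo_cap (F : fieldType) (n m : nat)
    (E : {fset {vspace 'rV[F]_m}}) : Prop :=
  (forall A, A \in E -> \dim A = n) /\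
  (forall A B D, A \in E -> B \in E -> D \in E ->
     uniq [:: A; B; D] -> \dim (A + B + D) = (3 * n)%N).

Definition weak_egg (F : finFieldType) (n : nat)
    (E : {fset {vspace 'rV[F]_(4 * n)}}) : Prop :=
  pseudo_cap n E /\ #|` E| = (#|F| ^ (2 * n) + 1)%N.

Definition good_at (F : finFieldType) (n : nat)
    (E : {fset {vspace 'rV[F]_(4 * n)}}) (X : {vspace 'rV[F]_(4 * n)}) : Prop :=
  X \in E /\
  forall W : {vspace 'rV[F]_(4 * n)},
    \dim W = (3 * n)%N -> (X <= W)%VS ->
    (2 <= #|` [fset A in E | (A != X) && (A <= W)%VS]|)%N ->
    #|` [fset A in E | (A <= W)%VS]| = (#|F| ^ n + 1)%N.

(* L plays the role of the field with q ^ n elements, and f is an F-linear    *)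
(* identification of F^(r n) with L^r, where F acts on L^r through F -> L.    *)
(* A point P of PG(r - 1, q ^ n) then corresponds to the F-subspace of        *)
(* F^(r n) formed by the vectors that f maps into P.                          *)
Definition elementary (F : finFieldType) (r n : nat)
    (E : {fset {vspace 'rV[F]_(r * n)}}) : Prop :=
  exists (L : fieldExtType F)
         (f : {linear 'rV[F]_(r * n) -> 'rV[L]_r | in_alg L \; *:%R})
         (C : {fset {vspace 'rV[L]_r}}),
    [/\ \dim {:L} = n, bijective f, cap C &
        forall A, A \in E <->
          exists2 P, P \in C & forall v, (v \in A) = (f v \in P)].

Arguments weak_egg {F} n E.
Arguments good_at {F} n E X.
Arguments elementary {F} r n E.

(* Main.v *)
Require Import Defs.
From HB Require Import structures.
From mathcomp Require Import all_boot all_order all_algebra all_field finmap.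
From mathcomp Require Import zify.

Set Implicit Arguments.
Unset Strict Implicit.
Unset Printing Implicit Defensive.

Import GRing.Theory.
Local Open Scope ring_scope.

(* Write Q = q ^ n and V = F_q^(4n).  Modulo a good element U, the other
   elements of E become Q^2 pairwise disjoint n-spaces of the 3n-space V / U, any
   two of which span a 2n-space containing exactly Q of them: an affine plane.
   The vectors covered by none of them form a subspace, the line at infinity, and
   the plane turns out to be Desarguesian: for nonzero a and any a' in the same
   member, some additive map preserves all members and sends a to a'.

   If U and W are both good, take A in E distinct from them, a nonzero s in A, and
   s' in A.  This yields additive maps phi1 of V / U and phi2 of V / W, both
   sending s to s'.  On V / (U + W) both preserve the spread formed by the images of
   the elements of E, and they agree at s, hence they are equal there.  As V is
   the fibre product of V / U and V / W over V / (U + W), they glue to an additive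
   map of V that preserves every element of E.  So the additive maps preserving
   every element of E form a ring L without zero divisors, in bijection with A
   by evaluation at s.  By Wedderburn's theorem L is a field with q ^ n elements;
   it contains F_q, hence consists of F_q-linear maps, and the elements of E are
   one-dimensional over L in V = L^4. *)

(** * Finite division algebras over [F] are field extensions *)

Section FieldOfMul.

Variables (F : finFieldType) (n : nat).
Variables (mul : 'rV[F]_n -> 'rV[F]_n -> 'rV[F]_n) (one : 'rV[F]_n).
Hypotheses (mulA : associative mul) (mul1x : left_id one mul)
  (mulx1 : right_id one mul).
Hypotheses (mulDl : left_distributive mul +%R)
  (mulDr : right_distributive mul +%R).
Hypothesis mulZl : forall c x y, mul (c *: x) y = c *: mul x y.
Hypotheses (one_neq0 : one != 0)
  (mul_dom : forall x y, mul x y = 0 -> x = 0 \/ y = 0).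

(** A separate name for the row vectors, so that the ring structure given by [mul] is attached to it
    and not to the row vectors themselves. *)
Definition mul_carrier : Type := 'rV[F]_n.
Local Notation T := mul_carrier.
HB.instance Definition _ := Finite.on T.
HB.instance Definition _ := Vector.on T.
HB.instance Definition _ :=
  GRing.Zmodule_isNzRing.Build T mulA mul1x mulx1 mulDl mulDr one_neq0.
HB.instance Definition _ := FinRing.isNzRing.Build T.

Let mul_domain : GRing.integral_domain_axiom T.
Proof.
move=> x y /mul_dom[->|->]; rewrite eqxx ?orbT //.
Qed.

Let mulC : @commutative T T *%R.
Proof. exact: finDomain_mulrC mul_domain. Qed.

Let field_T : GRing.field_axiom T.
Proof. exact: finDomain_field mul_domain. Qed.

HB.instance Definition _ := GRing.PzRing_hasCommutativeMul.Build T mulC.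

HB.instance Definition _ :=
  GRing.ComUnitRing_isIntegral.Build T mul_domain.
HB.instance Definition _ := GRing.UnitRing_isField.Build T field_T.

Let scalerAl_T (c : F) (x y : T) : c *: (x * y) = (c *: x) * y.
Proof. by rewrite [RHS]mulZl. Qed.

HB.instance Definition _ := GRing.Lmodule_isLalgebra.Build F T scalerAl_T.
HB.instance Definition _ := GRing.Lalgebra_isComAlgebra.Build F T.

(** A finite ring without zero divisors is commutative by Wedderburn's theorem, hence a field.
    Commutativity also turns the one-sided law [mulZl] into a full algebra structure. *)
Lemma fieldExt_of_mul :
  exists (L : fieldExtType F) (h : {linear 'rV[F]_n -> L}),
    [/\ \dim {:L} = n, bijective h & forall x y, h (mul x y) = h x * h y].
Proof.
exists (T : fieldExtType F), (idfun : {linear T -> T}); split=> //.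
  by rewrite dimvf /dim /= mul1n.
by exists idfun.
Qed.

End FieldOfMul.
(* For [v] outside the member through [s], [psi v] lies in the member through
   [v] and in the one through [v + s], which differ and so meet in [B]. *)
Lemma spread_kernel (X : zmodType) (J : Type) (G : J -> {pred X})
    (B : {pred X}) (psi : X -> X) (s : X) :
  (forall j, GRing.zmod_closed (G j)) -> GRing.zmod_closed B ->
  (forall j, {subset B <= G j}) -> (forall v, exists j, v \in G j) ->
  (forall j k v, v \in G j -> v \in G k -> v \notin B -> {subset G j <= G k}) ->
  (forall j, exists v, v \notin G j) ->
  {morph psi : x y / x + y} -> (forall j v, v \in G j -> psi v \in G j) ->
  s \notin B -> psi s \in B -> forall v, psi v \in B.
Proof.
move=> GZ [B0 BB] BG cov inter prop psiD psiG sB psB.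
have [j0 sj0] := cov s.
have out v : v \notin G j0 -> psi v \in B.
  move=> vj0; have [j vj] := cov v; have [k vsk] := cov (v + s).
  have pk : psi v \in G k.
    have -> : psi v = psi (v + s) - psi s by rewrite psiD addrK.
    by case: (GZ k) => _; apply; [apply: psiG | apply: BG].
  apply/negPn/negP => npB.
  have vk := inter _ _ _ (psiG _ _ vj) pk npB _ vj.
  have sk : s \in G k.
    have -> : s = (v + s) - v by rewrite addrC addKr.
    by case: (GZ k) => _; apply.
  by move/negP: vj0; apply; apply: (inter _ _ _ sk sj0 sB).
move=> v; case: (boolP (v \in G j0)) => vj0; last exact: out.
have [w wj0] := prop j0.
have vwj0 : v + w \notin G j0.
  apply: contra wj0 => vwj0; have -> : w = (v + w) - v by rewrite addrC addKr.
  by case: (GZ j0) => _; apply.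
have -> : psi v = psi (v + w) - psi w by rewrite psiD addrK.
by apply: BB; apply: out.
Qed.

(** * Affine spreads *)

Section AffineSpread.

Variables (X : finZmodType) (I : finType) (S : I -> {set X}) (Q : nat).

Definition line i j : {set X} := [set x + y | x in S i, y in S j].

(* The group [X] is not assumed to be a vector space: the maps constructed here
   are only additive, and their linearity over the base field is a consequence of
   Wedderburn's theorem. *)
Hypotheses (Q_gt1 : (1 < Q)%N) (cardX : #|X| = (Q ^ 3)%N)
  (cardI : #|I| = (Q ^ 2)%N) (cardS : forall i, #|S i| = Q).
Hypotheses (S0 : forall i, 0 \in S i)
  (SB : forall i x y, x \in S i -> y \in S i -> x - y \in S i).
Hypothesis Sdisj : forall i j x, x \in S i -> x \in S j -> x != 0 -> i = j.
Hypothesis card_pts : forall i j, i != j ->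
  #|[set k | S k \subset line i j]| = Q.

Lemma SN i x : x \in S i -> - x \in S i.
Proof. by move=> xi; rewrite -sub0r SB. Qed.

Lemma SD i x y : x \in S i -> y \in S i -> x + y \in S i.
Proof. by move=> xi yi; rewrite -[y]opprK SB ?SN. Qed.

Lemma lineP i j x :
  reflect (exists2 y, y \in S j & x - y \in S i) (x \in line i j).
Proof.
apply: (iffP imset2P) => [[a y ai yj ->]|[y yj xy]].
  by exists y; rewrite ?addrK.
by exists (x - y) y; rewrite ?subrK.
Qed.

Lemma lineB i j x y : x \in line i j -> y \in line i j -> x - y \in line i j.
Proof.
move=> /lineP[a aj xa] /lineP[b bj yb]; apply/lineP; exists (a - b); first exact: SB.
have -> : x - y - (a - b) = (x - a) - (y - b) by rewrite !opprD !opprK addrACA.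
exact: SB.
Qed.

Lemma line_l i j : {subset S i <= line i j}.
Proof. by move=> x xi; apply/lineP; exists 0; rewrite ?subr0. Qed.

Lemma line_r i j : {subset S j <= line i j}.
Proof. by move=> x xj; apply/lineP; exists x; rewrite ?subrr. Qed.

Lemma line0 i j : 0 \in line i j.
Proof. exact/line_l/S0. Qed.

Lemma lineN i j x : x \in line i j -> - x \in line i j.
Proof. by move=> xl; rewrite -sub0r lineB ?line0. Qed.

Lemma lineD i j x y : x \in line i j -> y \in line i j -> x + y \in line i j.
Proof. by move=> xl yl; rewrite -[y]opprK lineB ?lineN. Qed.

Lemma line_subset i j k l :
  S k \subset line i j -> S l \subset line i j -> line k l \subset line i j.
Proof.
move=> /subsetP kl /subsetP ll; apply/subsetP => x /lineP[y yl xy].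
by rewrite -[x](subrK y); apply: lineD; [apply: kl | apply: ll].
Qed.

Lemma lineC i j : line i j = line j i.
Proof.
have H k l : line k l \subset line l k.
  by apply: line_subset; apply/subsetP; [apply: line_r | apply: line_l].
by apply/eqP; rewrite eqEsubset !H.
Qed.

Lemma line_ii i : line i i = S i.
Proof.
apply/eqP; rewrite eqEsubset; apply/andP; split; apply/subsetP => x.
  by move=> /lineP[s si xs]; rewrite -[x](subrK s) SD.
exact: line_l.
Qed.

Lemma card_line i j : i != j -> #|line i j| = (Q ^ 2)%N.
Proof.
move=> ij; have -> : line i j = [set p.1 + p.2 | p in setX (S i) (S j)].
  apply/setP => x; apply/lineP/imsetP => [[y yj xy]|[[a b]]] /=.
    by exists (x - y, y); rewrite ?inE /= ?subrK ?xy.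
  by rewrite inE /= => /andP[ai bj] ->; exists b; rewrite // addrK.
rewrite card_in_imset ?cardsX ?cardS // => -[a b] [a' b'].
rewrite !inE /= => /andP[ai bj] /andP[a'i b'j] E.
have D : a - a' = b' - b.
  by rewrite -(addrK b a) E addrAC [a' + b']addrC addrK.
have [E0|nz] := eqVneq (a - a') 0.
  by congr (_, _); apply/eqP; [|rewrite eq_sym]; rewrite -subr_eq0 -?D E0.
by move/eqP: ij; case; apply: (Sdisj _ _ nz); [apply: SB | rewrite D; apply: SB].
Qed.

Lemma line_eq i j k :
  i != j -> k != i -> S k \subset line i j -> line i k = line i j.
Proof.
rewrite [k == _]eq_sym => ij ki kl; apply/eqP; rewrite eqEcard !card_line //.
by rewrite leqnn line_subset //; apply/subsetP/line_l.
Qed.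

Lemma line_eq2 i j k l : i != j -> k != l ->
  S k \subset line i j -> S l \subset line i j -> line k l = line i j.
Proof.
move=> ij kl ksub lsub; apply/eqP; rewrite eqEcard !card_line //.
by rewrite leqnn line_subset.
Qed.

(** For distinct [i] and [l], the component of [v] in [S l] along the direct sum of [S i] and [S l];
    the default 0 only serves vectors off that sum. *)
Definition comp i l v := odflt 0 [pick x in S l | v - x \in S i].

Lemma compP i l v : v \in line i l -> comp i l v \in S l /\ v - comp i l v \in S i.
Proof.
move=> /lineP[y yl vy]; rewrite /comp; case: pickP => [x /andP[] //|/(_ y)].
by rewrite yl vy.
Qed.

(** Since [v] is not in [S i], its components are nonzero, and a nonzero vector lies in at most one
    member. *)
Lemma comp_inj i v : v \notin S i ->
  {in [pred l | v \in line i l] &, injective (fun l => comp i l v)}.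
Proof.
move=> vi k l kv lv E; have [ck vk] := compP kv; have [cl vl] := compP lv.
apply: (Sdisj ck); first by rewrite E.
by apply: contraNneq vi => c0; rewrite c0 subr0 in vk.
Qed.

Lemma card_coset i v : #|[set x | v - x \in S i]| = Q.
Proof.
rewrite -(cardS i) -(card_imset (mem (S i)) (can_inj (subKr v))).
apply: eq_card => x; rewrite inE; apply/idP/imsetP => [vx|[y yi ->]].
  by exists (v - x); rewrite ?subKr.
by rewrite subKr.
Qed.

Lemma card_pts1 i j : i != j ->
  #|[set k | (k != i) && (S k \subset line i j)]| = Q.-1.
Proof.
move=> ij; rewrite -(card_pts ij) (cardsD1 i [set k | S k \subset line i j]).
rewrite inE; have -> : S i \subset line i j by apply/subsetP/line_l.
by apply: eq_card => k; rewrite !inE.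
Qed.

Lemma card_comps i j v : i != j -> v \in line i j -> v \notin S i ->
  #|[set comp i l v | l in [set l | (l != i) && (S l \subset line i j)]]| = Q.-1.
Proof.
move=> ij vj vi; rewrite card_in_imset ?card_pts1 // => k l.
rewrite !inE => /andP[ki kl] /andP[li ll]; apply: comp_inj => //.
  by rewrite inE (line_eq ij ki kl).
by rewrite inE (line_eq ij li ll).
Qed.

(* If [x] violated this, the coset of [S i] through [x] would contain Q - 1
   vectors covered by the line of [i] and [j] and Q - 1 other vectors covered
   by the line of [i] and [k], whence Q = 2, and then [S k] is [{0, x}]. *)
Lemma line_indep i j k x : i != j -> x \in S k -> x \in line i j -> x != 0 ->
  S k \subset line i j.
Proof.
move=> ij xk xl x0; apply: contraT => nk.
have ki : k != i by apply: contraNneq nk => ->; apply/subsetP/line_l.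
have xi : x \notin S i by apply: contraNN ki => xi; rewrite (Sdisj xk xi x0).
have ik : i != k by rewrite eq_sym.
have xlk : x \in line i k by apply: line_r.
pose N j := [set comp i l x | l in [set l | (l != i) && (S l \subset line i j)]].
have Nsub h : i != h -> x \in line i h -> N h \subset [set y | x - y \in S i].
  move=> ih xh; apply/subsetP => _ /imsetP[l + ->]; rewrite !inE => /andP[li ll].
  by apply: (proj2 (compP _)); rewrite (line_eq ih li ll).
have dis : N j :&: N k = set0.
  apply/eqP; rewrite -subset0; apply/subsetP => y; rewrite inE => /andP[].
  case/imsetP=> l + ->; rewrite inE => /andP[li ll].
  case/imsetP=> m + E; rewrite inE => /andP[mi mm].
  have lE := line_eq ij li ll; have mE := line_eq ik mi mm.
  have lm : l = m.
    by apply: (comp_inj xi _ _ E); rewrite inE ?lE ?mE.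
  by case/negP: nk; rewrite -lE lm mE; apply/subsetP/line_r.
have : (#|N j :|: N k| <= Q)%N.
  by rewrite -(card_coset i x) subset_leq_card // subUset !Nsub.
rewrite cardsU dis cards0 subn0 !card_comps // => Qle.
have Q2 : Q = 2 by lia.
have S2 : S k = [set 0; x].
  apply/eqP; rewrite eq_sym eqEcard cardS Q2 cards2 eq_sym x0 andbT.
  by apply/subsetP => y; rewrite !inE => /orP[] /eqP->.
by case/negP: nk; rewrite S2; apply/subsetP => y /set2P[]->; rewrite ?line0.
Qed.

(** If [v] is on [line i l], its component in [S l] is a nonzero vector of [line i k], so
    [line_indep] puts all of [S l] there. Thus two lines through [i] sharing a vector outside [S i]
    coincide. *)
Lemma through_line i v k : v \notin S i -> k != i -> v \in line i k ->
  [set l | (l != i) && (v \in line i l)] =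
  [set l | (l != i) && (S l \subset line i k)].
Proof.
move=> vi ki vk; have ik : i != k by rewrite eq_sym.
apply/setP => l; rewrite !in_set; case: (boolP (l == i)) => //= li.
apply/idP/idP => [vl|ll]; last by rewrite (line_eq ik li ll).
have [cl vc] := compP vl.
apply: (line_indep ik cl); last by apply: contraNneq vi => c0; rewrite c0 subr0 in vc.
by rewrite -[comp _ _ _](subKr v); apply: lineB => //; apply: line_l.
Qed.

(** Each [v] outside [S i] has at most Q - 1 such [k], by [through_line]. Counting pairs by [k]
    gives (Q^2 - 1)(Q^2 - Q) = (Q^3 - Q)(Q - 1), so the bound is attained by every [v]. *)
Lemma card_through i v : v \notin S i ->
  #|[set k | (k != i) && (v \in line i k)]| = Q.-1.
Proof.
pose J v := [set k | (k != i) && (v \in line i k)].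
have Jle w : w \in ~: S i -> (#|J w| <= Q.-1)%N.
  rewrite in_setC => wi; have [->|[k]] := set_0Vmem (J w); first by rewrite cards0.
  rewrite in_set => /andP[ki wk].
  by rewrite /J (through_line wi ki wk) card_pts1 // eq_sym.
have E : (\sum_(w in ~: S i) #|J w| = \sum_(w in ~: S i) Q.-1)%N.
  under eq_bigr => w _ do rewrite -sum1dep_card.
  rewrite (exchange_big_dep (fun k => k != i)) /=; last by move=> w k _ /andP[].
  rewrite (eq_bigr (fun=> (Q ^ 2 - Q)%N)) => [|k ki]; last first.
    have ik : i != k by rewrite eq_sym.
    rewrite sum1dep_card -(card_line ik) -(cardS i).
    rewrite -[in RHS](setIidPr (introT subsetP (@line_l i k))) -cardsD.
    by apply: eq_card => w; rewrite !inE ki.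
  rewrite !sum_nat_const cardsCs setCK cardS cardX.
  have -> : #|[pred k | k != i]| = (Q ^ 2 - 1)%N.
    by rewrite -cardI subn1 -(cardC1 i).
  nia.
move=> vi; have [_] := leqif_sum (fun w wi => leqif_eq (Jle w wi)).
by rewrite E eqxx => /esym/forall_inP/(_ v); rewrite inE => /(_ vi)/eqP.
Qed.

Lemma through_ex i v : exists2 k, k != i & v \in line i k.
Proof.
case: (boolP (v \in S i)) => vi; last first.
  have /card_gt0P[k] : (0 < #|[set k | (k != i) && (v \in line i k)]|)%N.
    by rewrite card_through // -subn1 subn_gt0.
  by rewrite in_set => /andP[ki vk]; exists k.
have /subsetPn[k _] : ~~ ([set: I] \subset [set i]).
  by apply/negP => /subset_leq_card; rewrite cardsT cards1 cardI; nia.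
by rewrite in_set1 => ki; exists k => //; apply: line_l.
Qed.

(** * Holes: the line at infinity *)

Definition holes : {set X} :=
  locked [set x | [forall k, (x \in S k) ==> (x == 0)]].

Lemma holesP x : reflect (forall k, x \in S k -> x = 0) (x \in holes).
Proof.
rewrite /holes -lock inE; apply: (iffP forallP) => [H k xk|H k].
  by have /implyP/(_ xk)/eqP := H k.
by apply/implyP => /H ->.
Qed.

Lemma hole_notin i h : h \in holes -> h != 0 -> h \notin S i.
Proof. by move=> /holesP hH; apply: contraNN => /hH ->. Qed.

(** The Q - 1 members [k] with [v] on [line i k] cover one element each of the coset of [S i]
    through [v], and these elements are distinct. Of its Q elements exactly one is left
    uncovered. *)
Lemma card_coset_holes i v : v \notin S i ->
  #|[set x in holes | v - x \in S i]| = 1%N.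
Proof.
move=> vi; pose J := [set k | (k != i) && (v \in line i k)].
pose N := [set comp i l v | l in J].
have cN : #|N| = Q.-1.
  rewrite card_in_imset ?card_through // => k l.
  by rewrite !in_set => /andP[_ vk] /andP[_ vl]; apply: comp_inj.
have -> : [set x in holes | v - x \in S i] = [set x | v - x \in S i] :\: N.
  apply/setP => x; rewrite in_setD !in_set.
  case: (boolP (v - x \in S i)) => vx; rewrite ?andbT ?andbF //.
  apply/idP/idP => [xH|xN].
    apply/imsetP => -[l + xl]; rewrite in_set => /andP[_ /compP[]].
    rewrite -xl => /(holesP _ xH) x0; rewrite x0 subr0 => {}vx.
    by rewrite vx in vi.
  apply/holesP => k xk; apply/eqP; apply: contraR xN => x0.
  have ki : k != i.
    apply: contraNneq vi => ki; rewrite ki in xk.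
    by rewrite -[v](subrK x); apply: SD.
  have vk : v \in line i k by apply/lineP; exists x.
  apply/imsetP; exists k; first by rewrite in_set ki.
  have [ck vc] := compP vk; apply/eqP; rewrite -subr_eq0.
  have xck : x - comp i k v \in S k by apply: SB.
  have xci : x - comp i k v \in S i.
    by rewrite -(subrKA v) addrC -[x - v]opprB; apply: SB.
  by apply: contraNT ki => nz; apply/eqP; apply: (Sdisj xck xci nz).
rewrite cardsD card_coset (setIidPr _) ?cN; first by lia.
apply/subsetP => _ /imsetP[l + ->]; rewrite !in_set => /andP[_ vl].
exact: (proj2 (compP vl)).
Qed.

Lemma hole_uniq i h h' : h \in holes -> h' \in holes -> h - h' \in S i -> h = h'.
Proof.
move=> hH h'H hh'; case: (boolP (h \in S i)) => hi.
  have h0 := holesP _ hH _ hi; rewrite h0 sub0r in hh' *.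
  by rewrite (holesP _ h'H i) // -[h']opprK SN.
have /eqP/cards1P[x E] := card_coset_holes hi.
have : h \in [set x in holes | h - x \in S i] by rewrite in_set hH subrr S0.
have : h' \in [set x in holes | h - x \in S i] by rewrite in_set h'H.
by rewrite E !inE => /eqP -> /eqP.
Qed.

(** The projection onto [holes] along [S i]: each coset of [S i] contains exactly one hole, and once
    [holes] is known to be a subgroup, [X] is the direct sum of the two. *)
Definition hproj i v := odflt 0 [pick h in holes | v - h \in S i].

Lemma hprojP i v : hproj i v \in holes /\ v - hproj i v \in S i.
Proof.
rewrite /hproj; case: pickP => [h /andP[] //|no] /=.
case: (boolP (v \in S i)) => vi; first by rewrite subr0; split=> //; apply/holesP.
have /eqP/cards1P[x E] := card_coset_holes vi.
by have := set11 x; rewrite -E in_set no.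
Qed.

Lemma hproj_in i v : hproj i v \in holes. Proof. by have [] := hprojP i v. Qed.

Lemma hproj_sub i v : v - hproj i v \in S i. Proof. by have [] := hprojP i v. Qed.

Lemma hproj_eq i v h : h \in holes -> v - h \in S i -> hproj i v = h.
Proof.
move=> hH vh; apply: (hole_uniq (hproj_in i v) hH (i := i)).
by rewrite -[hproj i v](subKr v) addrAC SB ?hproj_sub.
Qed.

Lemma hproj_hole i h : h \in holes -> hproj i h = h.
Proof. by move=> hH; apply: hproj_eq => //; rewrite subrr. Qed.

Lemma hproj_S i v : v \in S i -> hproj i v = 0.
Proof. by move=> vi; apply: hproj_eq; rewrite ?subr0 //; apply/holesP. Qed.

(* A difference [h - h'] of holes lying in [S k] would put the holes [h] and
   [h'] in the same coset of [S k]. *)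
Lemma holesB h h' : h \in holes -> h' \in holes -> h - h' \in holes.
Proof.
by move=> hH h'H; apply/holesP => k /(hole_uniq hH h'H) ->; rewrite subrr.
Qed.

Lemma holes0 : 0 \in holes. Proof. exact/holesP. Qed.

Lemma holesN h : h \in holes -> - h \in holes.
Proof. by move=> hH; rewrite -sub0r holesB ?holes0. Qed.

Lemma holesD h h' : h \in holes -> h' \in holes -> h + h' \in holes.
Proof. by move=> hH h'H; rewrite -[h']opprK holesB ?holesN. Qed.

Lemma hprojB i x y : hproj i (x - y) = hproj i x - hproj i y.
Proof.
apply: hproj_eq; first by rewrite holesB ?hproj_in.
have -> : x - y - (hproj i x - hproj i y) = (x - hproj i x) - (y - hproj i y).
  by rewrite !opprD !opprK addrACA.
by rewrite SB ?hproj_sub.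
Qed.

Lemma hprojN i x : hproj i (- x) = - hproj i x.
Proof. by rewrite -sub0r hprojB hproj_S ?sub0r. Qed.

Lemma hprojD i x y : hproj i (x + y) = hproj i x + hproj i y.
Proof. by rewrite -{1}[y]opprK hprojB hprojN opprK. Qed.

Lemma card_holes : #|holes| = (Q ^ 2)%N.
Proof.
have /card_gt0P[i _] : (0 < #|I|)%N by rewrite cardI expn_gt0 (ltnW Q_gt1).
have : #|[set p.1 + p.2 | p in setX (S i) holes]| = #|X|.
  rewrite -cardsT; congr #|pred_of_set _|; apply/setP => x; rewrite in_setT.
  apply/imsetP; exists (x - hproj i x, hproj i x); last by rewrite /= subrK.
  by rewrite in_setX hproj_sub hproj_in.
rewrite card_in_imset => [|[a h] [a' h']].
  by rewrite cardsX cardS cardX expnS => /eqP; rewrite eqn_pmul2l; [move/eqP | lia].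
rewrite !in_setX /= => /andP[ai hH] /andP[a'i h'H] E.
have hh' : h = h'.
  rewrite -(hproj_hole i hH) -(hproj_hole i h'H).
  by have := congr1 (hproj i) E; rewrite !hprojD (hproj_S ai) (hproj_S a'i) !add0r.
by move: E; rewrite hh' => /addIr ->.
Qed.

(** [hproj i] restricts to a bijection from [S j] onto the holes of the line. *)
Lemma card_line_holes i j : i != j -> #|line i j :&: holes| = Q.
Proof.
move=> ij; rewrite -[RHS](cardS j) -(@card_in_imset _ _ (hproj i) (mem (S j))).
  apply: eq_card => h; rewrite in_setI; apply/andP/imsetP => [[hl hH]|[s sj ->]].
    have [s sj hs] := lineP _ _ _ hl; exists s => //.
    by apply/esym/hproj_eq => //; rewrite -opprB SN.
  rewrite hproj_in -[hproj i s](subKr s); split=> //.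
  by apply: lineB; [apply: line_r | apply/line_l/hproj_sub].
move=> s s' sj s'j E; apply/eqP; rewrite -subr_eq0.
apply: contraNT ij => nz; apply/eqP/(Sdisj _ _ nz); last exact: SB.
by rewrite -[s - s']subr0 -(subrr (hproj i s)) {2}E -hprojB hproj_sub.
Qed.

(** * Intersection and parallelism of lines *)

Lemma line_spanned i j p : i != j -> S p \subset line i j ->
  exists2 k, k != p & line p k = line i j.
Proof.
move=> ij pl; have [pi|pi] := eqVneq p i.
  by exists j; rewrite pi // eq_sym.
by exists i; rewrite 1?eq_sym // lineC; apply: line_eq.
Qed.

(** Both lines can be spanned from the common point [p], and [through_line] leaves only one line
    through [p] that contains [g]. *)
Lemma line_meet i j k l p g : i != j -> k != l ->
  S p \subset line i j -> S p \subset line k l -> g \notin S p ->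
  g \in line i j -> g \in line k l -> line i j = line k l.
Proof.
move=> ij kl pij pkl gp; have [m mp <-] := line_spanned ij pij.
have [m' m'p <-] := line_spanned kl pkl => gm gm'.
have : m' \in [set l | (l != p) && (g \in line p l)] by rewrite in_set m'p.
rewrite (through_line gp mp gm) in_set => /andP[_ m'm].
by apply/esym/line_eq; rewrite // eq_sym.
Qed.

(* The Q lines joining [i] to the points of [line k l] have Q(Q - 1) nonzero
   holes outside of [line k l], and that is all of them; so a line through [i]
   that is disjoint from [line k l] has its holes on it. *)
Lemma disjoint_line_holes i j k l h : i != j -> k != l ->
  (forall p, S p \subset line i j -> ~~ (S p \subset line k l)) ->
  h \in holes -> h \in line i j -> h \in line k l.
Proof.
move=> ij kl dis hH hij; apply: contraT => hkl.
pose P := [set t | S t \subset line k l].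
have ikl : ~~ (S i \subset line k l) by apply: dis; apply/subsetP/line_l.
have Pi t : S t \subset line k l -> i != t.
  by move=> tkl; apply: contraNneq ikl => ->.
have nz x : x \notin line k l -> x != 0 by apply: contraNneq => ->; apply: line0.
pose f x := #|[set t | (t \in P) && (x \in line i t)]|.
have f1 x : x \in holes :\: line k l -> (f x <= 1)%N.
  rewrite in_setD => /andP[xkl xH]; rewrite leqNgt; apply/card_gt1P => -[t [u []]].
  rewrite !in_set => /andP[tP xt] /andP[uP xu] tu.
  have itu : line i t = line i u.
    apply: (line_meet (p := i) (Pi _ tP) (Pi _ uP) _ _ _ xt xu).
    - exact/subsetP/line_l.
    - exact/subsetP/line_l.
    - exact: hole_notin (nz _ xkl).
  case/negP: ikl.
  rewrite -(line_eq2 kl tu tP uP) (line_eq2 (Pi _ tP) tu).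
  - exact/subsetP/line_l.
  - exact/subsetP/line_r.
  - by rewrite itu; apply/subsetP/line_r.
(* Summed over [t] instead of [x]: each of the Q points [t] of [line k l] contributes the Q - 1
   nonzero holes of [line i t], while there are Q^2 - Q holes off [line k l]. *)
have E : (\sum_(x in holes :\: line k l) f x = \sum_(x in holes :\: line k l) 1)%N.
  rewrite /f; under eq_bigr => x _ do rewrite -sum1dep_card.
  rewrite (exchange_big_dep (fun t => t \in P)) /=; last by move=> x t _ /andP[].
  rewrite (eq_bigr (fun=> Q.-1)) => [|t tP]; last first.
    have tkl : S t \subset line k l by rewrite in_set in tP.
    rewrite sum1dep_card -(card_line_holes (Pi _ tkl)).
    rewrite [in RHS](cardsD1 0) in_setI line0 holes0.
    apply: eq_card => x; rewrite in_set !in_setD tP in_setI in_set1 /=.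
    apply/andP/andP => [[/andP[xkl xH] xt]|[x0 /andP[xt xH]]].
      by rewrite xt xH (nz _ xkl).
    rewrite xH xt andbT; split=> //; apply: contraNN ikl => xkl.
    rewrite -(line_meet (p := t) (Pi _ tkl) kl _ _ _ xt xkl).
    - exact/subsetP/line_l.
    - exact/subsetP/line_r.
    - exact: tkl.
    - exact: hole_notin.
  rewrite !sum_nat_const card_pts // cardsD card_holes setIC card_line_holes //.
  by nia.
(* Equality of the sums makes [f h] equal to 1, so [h] lies on [line i t] for a point [t] of
   [line k l]. This line shares [i] and [h] with [line i j], hence equals it, and [t] contradicts
   disjointness. *)
have [_] := leqif_sum (fun x xA => leqif_eq (f1 x xA)).
rewrite E eqxx => /esym/forall_inP/(_ h); rewrite in_setD hkl hH => /(_ isT)/cards1P[t Et].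
have := set11 t; rewrite -Et !in_set => /andP[tkl ht].
have it := Pi _ tkl.
suff tij : S t \subset line i j by have := dis t tij; rewrite tkl.
rewrite (line_meet (p := i) ij it _ _ _ hij ht).
- exact/subsetP/line_r.
- exact/subsetP/line_l.
- exact/subsetP/line_l.
- exact: hole_notin (nz _ hkl).
Qed.

(** If the lines share a point they coincide by [line_meet]; otherwise [disjoint_line_holes]
    applies. A nonzero hole therefore acts as a direction: it determines all the holes of any line
    through it. *)
Lemma parallel i j k l g h : i != j -> k != l -> g \in holes -> g != 0 ->
  g \in line i j -> g \in line k l -> h \in holes -> h \in line i j ->
  h \in line k l.
Proof.
move=> ij kl gH g0 gij gkl hH hij.
case: (boolP [exists p, (S p \subset line i j) && (S p \subset line k l)]).
  case/existsP=> p /andP[pij pkl].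
  by rewrite -(line_meet ij kl pij pkl _ gij gkl) ?hole_notin.
rewrite negb_exists => /forallP dis; apply: (disjoint_line_holes ij) => // p pij.
by have := dis p; rewrite pij.
Qed.

(** * Dilatations with centre [o] and the additive maps they induce *)

Section Homology.

Variables (o : I) (a0 : X).
Hypotheses (a0o : a0 \in S o) (a0_neq0 : a0 != 0).

(* The origin is [o]; the members of the spread are labelled by the holes [h]
   via the condition [a0 + h \in S (idx h)], and [a + slide a h \in S (idx h)]
   for all [a \in S o]. *)
Definition idx h := odflt o [pick k | a0 + h \in S k].

Definition slide a x := - hproj (idx (hproj o x)) a.

(** If no member contained [a0 + h], it would be a hole, and so would [a0], its difference with [h];
    but [a0] is a nonzero vector of [S o]. *)
Lemma idxP h : h \in holes -> a0 + h \in S (idx h).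
Proof.
move=> hH; rewrite /idx; case: pickP => // no; case/negP: a0_neq0.
suff /holesP/(_ o a0o)/eqP : a0 \in holes by [].
rewrite -[a0](addrK h) holesB //; apply/holesP => k.
by rewrite no.
Qed.

Lemma origin_hole_neq0 b h : b \in S o -> b != 0 -> h \in holes -> b + h != 0.
Proof.
move=> bo b0 hH; apply: contraNneq b0 => /eqP; rewrite addr_eq0 => /eqP E.
by rewrite (holesP b _ o bo) // E holesN.
Qed.

Lemma idx_eq h k : h \in holes -> a0 + h \in S k -> idx h = k.
Proof.
by move=> hH hk; apply: (Sdisj (idxP hH) hk); apply: origin_hole_neq0.
Qed.

Lemma idx0 : idx 0 = o.
Proof. by apply: idx_eq; rewrite ?holes0 // addr0. Qed.

Lemma idx_neq h : h \in holes -> h != 0 -> o != idx h.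
Proof.
move=> hH h0; apply: contraNneq (hole_notin o hH h0) => E.
by have := idxP hH; rewrite -E => /SB/(_ a0o); rewrite addrC addKr => ->.
Qed.

Lemma slide_in a x : slide a x \in holes.
Proof. by rewrite holesN ?hproj_in. Qed.

Lemma slideP a h : h \in holes -> a + slide a h \in S (idx h).
Proof. by move=> hH; rewrite /slide (hproj_hole o hH) hproj_sub. Qed.

Lemma slide_eq a h k g : h \in holes -> a0 + h \in S k -> g \in holes ->
  a + g \in S k -> slide a h = g.
Proof.
move=> hH hk gH gk; rewrite /slide (hproj_hole o hH) (idx_eq hH hk).
by rewrite (@hproj_eq k a (- g)) ?opprK ?holesN.
Qed.

Lemma slide_hproj a x : slide a x = slide a (hproj o x).
Proof. by rewrite /slide (hproj_hole _ (hproj_in _ _)). Qed.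

Lemma slideBl a b x : slide (a - b) x = slide a x - slide b x.
Proof. by rewrite /slide hprojB opprD. Qed.

Lemma slideDl a b x : slide (a + b) x = slide a x + slide b x.
Proof. by rewrite /slide hprojD opprD. Qed.

Lemma slide_a0 h : h \in holes -> slide a0 h = h.
Proof. by move=> hH; apply: (slide_eq hH (idxP hH) hH (idxP hH)). Qed.

Lemma slide_0 a x : a \in S o -> hproj o x = 0 -> slide a x = 0.
Proof. by move=> ao x0; rewrite /slide x0 idx0 hproj_S ?oppr0. Qed.

Lemma translate_line b g k : b \in S o -> b + g \in S k -> g \in line o k.
Proof.
move=> bo bgk; have -> : g = (b + g) - b by rewrite addrC addKr.
by apply: lineB; [apply: line_r | apply: line_l].
Qed.

Lemma hole_line h : h \in holes -> h \in line o (idx h).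
Proof. by move=> hH; apply: translate_line a0o (idxP hH). Qed.

Lemma hole_line_eq h k : h \in holes -> h != 0 -> h \in line o k ->
  line o (idx h) = line o k.
Proof.
move=> hH h0 hk.
have ok : o != k.
  apply: contraNneq (hole_notin o hH h0) => ok; rewrite -ok in hk.
  by have [s so hs] := lineP _ _ _ hk; rewrite -[h](subrK s) SD.
apply: (line_meet (p := o) _ ok _ _ _ (hole_line hH) hk); rewrite ?idx_neq //.
- exact/subsetP/line_l.
- exact/subsetP/line_l.
- exact: hole_notin.
Qed.

Lemma hproj_line k x : x \in line o k -> hproj o x \in line o k.
Proof.
by move=> xk; rewrite -[hproj o x](subKr x); apply: lineB => //; apply/line_l/hproj_sub.
Qed.

Lemma slide_line a k x : a \in S o -> x \in line o k -> slide a x \in line o k.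
Proof.
move=> ao /hproj_line hk; have hH := hproj_in o x; rewrite slide_hproj.
have [h0|h0] := eqVneq (hproj o x) 0.
  by rewrite h0 (slide_0 ao) ?line0 // hproj_S.
rewrite -(hole_line_eq hH h0 hk).
exact: translate_line ao (slideP a hH).
Qed.

(** The line joining [idx h] and [idx h'] contains both [h - h'], the difference of [a0 + h] and
    [a0 + h'], and the difference of [a + slide a h] and [a + slide a h']. By [parallel] both have
    the same direction: [slide a] acts on labels as a dilatation. *)
Lemma slide_diff a h h' : a \in S o -> h \in holes -> h' \in holes -> h != h' ->
  slide a h - slide a h' \in line o (idx (h - h')).
Proof.
move=> ao hH h'H hh'; have gH := holesB hH h'H.
have g0 : h - h' != 0 by rewrite subr_eq0.
have E (b g g' : X) : g - g' = (b + g) - (b + g') by rewrite opprD addrACA subrr add0r.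
have diff k : h - h' \notin S k by apply: hole_notin.
apply: (@parallel (idx h) (idx h') o (idx (h - h')) (h - h')) => //.
- apply: contraNneq (diff (idx h)) => hk.
  by rewrite (E a0) SB ?idxP // hk idxP.
- exact: idx_neq.
- by rewrite (E a0); apply: lineB; [apply: line_l | apply: line_r]; apply: idxP.
- exact: hole_line.
- by rewrite holesB ?slide_in.
- by rewrite (E a); apply: lineB; [apply: line_l | apply: line_r]; apply: slideP.
Qed.

(** By [slide_diff], the defect of additivity lies on the line from [o] in the direction of [h], and
    also on the one in the direction of [h']. These lines differ, so the only hole they share is
    0. *)
Lemma slideD_indep a h h' : a \in S o -> h \in holes -> h' \in holes ->
  h != 0 -> h' != 0 -> h' \notin line o (idx h) ->
  slide a (h + h') = slide a h + slide a h'.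
Proof.
move=> ao hH h'H h0 h'0 h'h; apply/eqP; rewrite -subr_eq0.
set x := _ - _.
have xH : x \in holes by rewrite holesB ?holesD ?slide_in.
have sl h1 h2 : h1 \in holes -> h2 \in holes -> h1 != 0 -> h2 != 0 ->
    slide a (h1 + h2) - (slide a h1 + slide a h2) \in line o (idx h2).
  move=> h1H h2H h10 h20; rewrite opprD addrA; apply: lineB.
    have := @slide_diff a (h1 + h2) h1 ao (holesD h1H h2H) h1H.
    by rewrite [h1 + h2]addrC addrK -subr_eq0 addrK; apply.
  exact/slide_line/hole_line.
have xh' : x \in line o (idx h') by apply: sl.
have xh : x \in line o (idx h).
  by rewrite /x [h + h']addrC [slide a h + _]addrC; apply: sl.
apply: contraNT h'h => x0.
rewrite -(hole_line_eq xH x0 xh) (hole_line_eq xH x0 xh').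
exact: hole_line.
Qed.

Lemma hole_off_line h : h \in holes -> h != 0 ->
  exists2 g, g \in holes & g \notin line o (idx h).
Proof.
move=> hH h0; have : ~~ (holes \subset line o (idx h) :&: holes).
  apply/negP => /subset_leq_card.
  by rewrite card_holes card_line_holes ?idx_neq //; nia.
by case/subsetPn=> g gH; rewrite in_setI gH andbT; exists g.
Qed.

(** When [h] and [h'] have the same direction, a hole [g] off their line is added: expanding
    [slide a (h + h' + g)] in two ways needs only the independent case. *)
Lemma slideD_holes a h h' : a \in S o -> h \in holes -> h' \in holes ->
  slide a (h + h') = slide a h + slide a h'.
Proof.
move=> ao hH h'H; have slide0 := slide_0 ao (hproj_S (S0 o)).
have [->|h0] := eqVneq h 0; first by rewrite slide0 !add0r.
have [->|h'0] := eqVneq h' 0; first by rewrite slide0 !addr0.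
case: (boolP (h' \in line o (idx h))) => [h'h|]; last exact: slideD_indep.
have [g gH gh] := hole_off_line hH h0.
have g0 : g != 0 by apply: contraNneq gh => ->; apply: line0.
have add x : x \in holes -> x \in line o (idx h) ->
    slide a (x + g) = slide a x + slide a g.
  move=> xH xh; have [->|x0] := eqVneq x 0; first by rewrite slide0 !add0r.
  by apply: slideD_indep => //; rewrite (hole_line_eq xH x0 xh).
apply: (addIr (slide a g)).
rewrite -add ?holesD ?lineD ?hole_line // -addrA -[RHS]addrA -add //.
have gh' : h' + g \notin line o (idx h).
  by apply: contra gh => gh'; rewrite -(addKr h' g) addrC lineB.
apply: slideD_indep; rewrite ?holesD //.
by apply: contraNneq gh' => ->; apply: line0.
Qed.

Lemma slideDr a x y : a \in S o -> slide a (x + y) = slide a x + slide a y.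
Proof.
move=> ao; rewrite slide_hproj hprojD slideD_holes ?hproj_in //.
by rewrite -!slide_hproj.
Qed.

Lemma slide_inj a b h : a \in S o -> b \in S o -> h \in holes -> h != 0 ->
  slide a h = slide b h -> a = b.
Proof.
move=> ao bo hH h0 E; apply/eqP; rewrite -subr_eq0.
have : a - b + slide (a - b) h \in S (idx h) by apply: slideP.
rewrite slideBl E subrr addr0 => abh.
by apply: contraTT (idx_neq hH h0) => nz; rewrite (Sdisj (SB ao bo) abh nz) eqxx.
Qed.

Lemma slide_surj h g : h \in holes -> h != 0 -> g \in holes ->
  g \in line o (idx h) -> exists2 a, a \in S o & slide a h = g.
Proof.
move=> hH h0 gH /lineP[s sh gs]; exists (s - g); first by rewrite -opprB SN.
by apply: (slide_eq hH (idxP hH) gH); rewrite subrK.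
Qed.

Lemma line_neqT j : exists v, v \notin line o j.
Proof.
suff /subsetPn[v _ vj] : ~~ ([set: X] \subset line o j) by exists v.
apply/negP => /subset_leq_card; rewrite cardsT cardX.
have [<-|oj] := eqVneq o j; last by rewrite card_line //; nia.
by rewrite line_ii cardS; nia.
Qed.

(** The difference of the two sides is additive, preserves every line through [o] and kills [h0], so
    [spread_kernel], applied to these lines modulo [S o], puts its values in [S o]. They are holes
    as well, hence zero. *)
Lemma slide_comp a1 b h0 c : a1 \in S o -> b \in S o -> c \in S o ->
  h0 \in holes -> h0 != 0 -> slide c h0 = slide a1 (slide b h0) ->
  forall x, slide a1 (slide b x) = slide c x.
Proof.
move=> a1o bo co h0H h00 E x; apply/eqP; rewrite -subr_eq0; apply/eqP.
pose psi y := slide a1 (slide b y) - slide c y.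
have psi_hole y : psi y \in holes by rewrite holesB ?slide_in.
apply: (holesP _ (psi_hole x) o); move: x.
apply: (@spread_kernel X I (fun k => mem (line o k)) (mem (S o)) psi h0).
- by move=> k; split=> [|y z]; [apply: line0 | apply: lineB].
- by split=> [|y z]; [apply: S0 | apply: SB].
- by move=> k y; apply: line_l.
- by move=> v; have [k _ vk] := through_ex o v; exists k.
- move=> j k v vj vk vo; suff -> : line o j = line o k by [].
  have oneq l : v \in line o l -> o != l.
    by apply: contraTneq => <-; rewrite line_ii.
  apply: (line_meet (p := o) (oneq _ vj) (oneq _ vk) _ _ vo vj vk).
  - exact/subsetP/line_l.
  - exact/subsetP/line_l.
- exact: line_neqT.
- move=> y z; rewrite /psi !slideDr // opprD addrACA //.
- by move=> k v vk; apply: lineB; rewrite ?slide_line //.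
- exact: hole_notin.
- by rewrite /psi E subrr; apply: S0.
Qed.

(* With [X] written as the sum of [S o] and [holes], [phi] is [slide a1] on
   [holes] and [theta] on [S o], where [slide (theta b)] is the composite of
   [slide a1] and [slide b]. *)
Lemma homology_on a1 h0 : a1 \in S o -> h0 \in holes -> h0 != 0 ->
  exists phi : X -> X, [/\ {morph phi : x y / x + y},
    forall k x, x \in S k -> phi x \in S k & phi a0 = a1].
Proof.
move=> a1o h0H h00.
(* [slide a1 (slide b h0)] remains on the line through [o] in the direction of [h0], so [slide_surj]
   yields a vector of [S o]; the default 0 is never taken for [b] in [S o]. *)
have [theta thP] : exists theta : X -> X, forall b, b \in S o ->
    theta b \in S o /\ slide (theta b) h0 = slide a1 (slide b h0).
  exists (fun b => odflt 0 [pick a in S o | slide a h0 == slide a1 (slide b h0)]).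
  move=> b bo; case: pickP => [a /andP[ao /eqP] //|no].
  have := slide_line a1o (slide_line bo (hole_line h0H)).
  by case/(slide_surj h0H h00 (slide_in _ _)) => a ao E; have := no a; rewrite ao E eqxx.
have thC b x : b \in S o -> slide a1 (slide b x) = slide (theta b) x.
  by move=> bo; have [tho E] := thP _ bo; apply: slide_comp E x.
have thD b b' : b \in S o -> b' \in S o -> theta (b + b') = theta b + theta b'.
  move=> bo b'o; have [t1 E1] := thP _ bo; have [t2 E2] := thP _ b'o.
  have [t3 E3] := thP _ (SD bo b'o).
  apply: (slide_inj t3 (SD t1 t2) h0H h00).
  by rewrite E3 slideDl slideDr // slideDl E1 E2.
exists (fun x => theta (x - hproj o x) + slide a1 x); split=> [x y|k x xk|].
- rewrite hprojD opprD addrACA thD ?hproj_sub // slideDr //.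
  by rewrite addrACA.
- set b := x - hproj o x; have bo : b \in S o by apply: hproj_sub.
  have hH := hproj_in o x; set h := hproj o x in b bo hH *.
  (* [g] is the label of [S k]. As [b + h] lies in [S k], [h] is [slide b g], and the image of [x]
     becomes [theta b + slide (theta b) g], again in [S k]. *)
  pose g := hproj k (- a0).
  have gH : g \in holes by apply: hproj_in.
  have gk : a0 + g \in S k.
    by have := SN (hproj_sub k (- a0)); rewrite opprB opprK addrC.
  have E : slide b g = h by apply: (slide_eq gH gk hH); rewrite subrK.
  rewrite slide_hproj -/h -E thC // -(idx_eq gH gk).
  exact: slideP.
- rewrite hproj_S // subr0 (slide_0 a1o) ?hproj_S // addr0.
  have [t E] := thP _ a0o; apply: (slide_inj t a1o h0H h00).
  by rewrite E slide_a0.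
Qed.

End Homology.

Lemma homology_ex o a0 a1 : a0 \in S o -> a0 != 0 -> a1 \in S o ->
  exists phi : X -> X, [/\ {morph phi : x y / x + y},
    forall k x, x \in S k -> phi x \in S k & phi a0 = a1].
Proof.
move=> a0o a00 a1o.
have /subsetPn[h hH] : ~~ (holes \subset [set 0]).
  by apply/negP => /subset_leq_card; rewrite card_holes cards1; nia.
by rewrite in_set1 => h0; apply: (homology_on a0o a00 a1o hH h0).
Qed.

End AffineSpread.
(** * Weak eggs *)

Lemma addvAC (K : fieldType) (vT : vectType K) :
  right_commutative (@addv K vT).
Proof. by move=> A B C; rewrite -!addvA [(B + C)%VS]addvC. Qed.

(** A model of the quotient by [U] in coordinates on a complement: [p] is the projection and [r] a
    linear section. *)
Lemma quotient_map (F : fieldType) (V : vectType F) (U : {vspace V}) :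
  exists (p : {linear V -> 'rV[F]_(\dim U^C)}) (r : {linear 'rV[F]_(\dim U^C) -> V}),
    [/\ cancel r p, forall v, v - r (p v) \in U & forall v, v \in U -> p v = 0].
Proof.
pose b := vbasis U^C; pose d := daddv_pi U^C U.
have cap0 : (U^C :&: U = 0)%VS by rewrite capvC capv_compl.
have full v : v \in (U^C + U)%VS by rewrite addvC addv_complf memvf.
pose p (v : V) : 'rV[F]_(\dim U^C) := \row_i coord b i (d v).
pose r (x : 'rV[F]_(\dim U^C)) : V := \sum_i x 0 i *: b`_i.
have p_lin : linear p.
  by move=> c u v; apply/rowP => i; rewrite !mxE !linearP.
have r_lin : linear r.
  move=> c x y; rewrite /r scaler_sumr -big_split; apply: eq_bigr => i _ /=.
  by rewrite !mxE scalerDl scalerA.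
pose pM := GRing.isLinear.Build _ _ _ _ p p_lin.
pose rM := GRing.isLinear.Build _ _ _ _ r r_lin.
pose pL : {linear V -> 'rV[F]_(\dim U^C)} := HB.pack p pM.
pose rL : {linear 'rV[F]_(\dim U^C) -> V} := HB.pack r rM.
have rW x : r x \in (U^C)%VS.
  by apply: memv_suml => i _; rewrite memvZ // vbasis_mem ?mem_nth ?size_tuple.
exists pL, rL; split=> [x|v|v vU] /=; last first.
- apply/rowP => i; rewrite !mxE; suff -> : d v = 0 by rewrite linear0.
  have := daddv_pi_add cap0 (full v); rewrite [X in _ + X]daddv_pi_id 1?capvC //.
  by move/(canRL (addrK _)); rewrite subrr.
- have -> : r (p v) = d v.
    rewrite [RHS](coord_vbasis (memv_pi U^C U v)).
    by apply: eq_bigr => i _; rewrite mxE.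
  by rewrite -{1}(daddv_pi_add cap0 (full v)) addrC addKr; apply: memv_pi.
- apply/rowP => i; rewrite mxE [d _]daddv_pi_id ?rW //.
  by rewrite /r coord_sum_free //; apply: basis_free (vbasisP _).
Qed.
Lemma card_vspace_rV (F : finFieldType) n (U : {vspace 'rV[F]_n}) :
  #|U| = (#|F| ^ \dim U)%N.
Proof.
pose b := vbasis U.
pose r (x : {ffun 'I_(\dim U) -> F}) : 'rV[F]_n := \sum_i x i *: b`_i.
have rU x : r x \in U.
  by apply: memv_suml => i _; rewrite memvZ // vbasis_mem ?mem_nth ?size_tuple.
have <- : #|[set r x | x in [set: {ffun 'I_(\dim U) -> F}]]| = #|U|.
  apply: eq_card => v; apply/imsetP/idP => [[x _ ->] //|vU].
  exists [ffun i => coord b i v]; rewrite // [LHS](coord_vbasis vU).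
  by apply: eq_bigr => i _; rewrite ffunE.
rewrite card_imset ?cardsT ?card_ffun ?card_ord // => x y E; apply/ffunP => i.
have fb := basis_free (vbasisP U).
by rewrite -(coord_sum_free x i fb) -(coord_sum_free y i fb) -/(r x) -/(r y) E.
Qed.

Lemma vspace_param (F : fieldType) (V : vectType F) (A : {vspace V}) n :
  \dim A = n -> exists e : {linear 'rV[F]_n -> V},
    injective e /\ forall v, v \in A <-> exists x, v = e x.
Proof.
move=> <-; pose b := vbasis A.
pose e (x : 'rV[F]_(\dim A)) : V := \sum_i x 0 i *: b`_i.
have e_lin : linear e.
  move=> c x y; rewrite /e scaler_sumr -big_split; apply: eq_bigr => i _ /=.
  by rewrite !mxE scalerDl scalerA.
pose eM := GRing.isLinear.Build _ _ _ _ e e_lin.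
pose eL : {linear 'rV[F]_(\dim A) -> V} := HB.pack e eM.
have fb := basis_free (vbasisP A).
exists eL; split=> [x y E|v].
  apply/rowP => i; rewrite -(coord_sum_free (fun i => x 0 i) i fb).
  by rewrite -(coord_sum_free (fun i => y 0 i) i fb) -/(e x) -/(e y) [e x]E.
split=> [vA|[x ->]]; last first.
  by apply: memv_suml => i _; rewrite memvZ // vbasis_mem ?mem_nth ?size_tuple.
exists (\row_i coord b i v); rewrite [LHS](coord_vbasis vA).
by apply: eq_bigr => i _; rewrite mxE.
Qed.

Section Egg.

Variables (F : finFieldType) (n : nat).
Local Notation V := 'rV[F]_(4 * n).
Variable E : {fset {vspace V}}.
Hypotheses (n_gt0 : (1 <= n)%N) (eggE : weak_egg n E).
Local Notation Q := (#|F| ^ n)%N.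

Lemma Q_gt1 : (1 < Q)%N.
Proof. by rewrite -(expn0 #|F|) ltn_exp2l ?card_finNzRing_gt1. Qed.

Lemma card_egg : #|` E| = (Q ^ 2 + 1)%N.
Proof. by have [_ ->] := eggE; rewrite -expnM (mulnC n). Qed.

Lemma egg_dim A : A \in E -> \dim A = n.
Proof. by case: eggE => -[h _] _; apply: h. Qed.

Lemma egg_dim3 A B D : A \in E -> B \in E -> D \in E ->
  A != B -> A != D -> B != D -> \dim (A + B + D)%VS = (3 * n)%N.
Proof.
move=> AE BE DE AB AD BD; have [[_ h] _] := eggE.
by apply: h => //=; rewrite !inE negb_or AB AD BD.
Qed.

(** A dimension count: [A] has dimension n, [B + D] at most 2n, and together they span dimension
    3n. *)
Lemma egg_cap A B D : A \in E -> B \in E -> D \in E ->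
  A != B -> A != D -> B != D -> (A :&: (B + D) = 0)%VS.
Proof.
move=> AE BE DE AB AD BD; apply/eqP; rewrite -dimv_eq0.
have := dimv_sum_cap A (B + D)%VS; rewrite addvA (egg_dim3 AE) // (egg_dim AE).
have := dimv_add_leqif B D; rewrite (egg_dim BE) (egg_dim DE) => -[+ _].
by move: (\dim _) (\dim _) => x y; lia.
Qed.

(** There are at least five elements, as Q is at least 2. The three spaces to avoid may coincide. *)
Lemma egg_fourth A B D : exists T, [/\ T \in E, T != A, T != B & T != D].
Proof.
have : (0 < #|` (E `\ A `\ B `\ D)%fset|)%N.
  have := cardfsD1 A E; have := cardfsD1 B (E `\ A)%fset; rewrite card_egg.
  have := cardfsD1 D (E `\ A `\ B)%fset.
  by have := Q_gt1; do 3!case: (_ \in _); nia.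
rewrite cardfs_gt0 => /fset0Pn[T]; rewrite !in_fsetD1 => /and4P[TD TB TA TE].
by exists T.
Qed.

Lemma egg_cap2 A B : A \in E -> B \in E -> A != B -> (A :&: B = 0)%VS.
Proof.
move=> AE BE AB; have [D [DE DA DB _]] := egg_fourth A B B.
apply/eqP; rewrite -subv0 -(egg_cap AE BE DE AB) 1?eq_sym //.
by rewrite capvS ?addvSl.
Qed.

(** * The affine spread in the quotient by a good element *)

Section Quotient.

Variable U : {vspace V}.
Hypothesis goodU : good_at n E U.
Variables (p : {linear V -> 'rV[F]_(\dim U^C)})
  (r : {linear 'rV[F]_(\dim U^C) -> V}).
Hypotheses (rK : cancel r p) (rpU : forall v, v - r (p v) \in U)
  (pU : forall v, v \in U -> p v = 0).

Let UE : U \in E := proj1 goodU.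

Local Notation I := (E `\ U)%fset.

(** The image of [val k] under [p], expressed through representatives so that questions about it
    become questions about subspaces of [V] containing [U]. *)
Definition img (k : I) : {set 'rV[F]_(\dim U^C)} :=
  [set x | r x \in (val k + U)%VS].

Let IE (k : I) : val k \in E.
Proof. by have := fsvalP k; rewrite in_fsetD1 => /andP[]. Qed.

Let IU (k : I) : val k != U.
Proof. by have := fsvalP k; rewrite in_fsetD1 => /andP[]. Qed.

Let neq_val (i j : I) : i != j -> val i != val j.
Proof. by rewrite (inj_eq val_inj). Qed.

Lemma rp_mem (W : {vspace V}) v : (U <= W)%VS -> (r (p v) \in W) = (v \in W).
Proof.
move=> /subvP UW; have vW := UW _ (rpU v).
by rewrite -{2}[v](subrK (r (p v))) rpredDl.
Qed.

Lemma imgP (k : I) x : reflect (exists2 v, v \in val k & x = p v) (x \in img k).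
Proof.
rewrite in_set; apply: (iffP idP) => [/memv_addP[v vk [u uU xE]]|[v vk ->]].
  by exists v => //; rewrite -[x]rK xE linearD (pU uU) addr0.
by rewrite rp_mem ?addvSr // (subvP (addvSl _ _)).
Qed.

Lemma mem_img (k : I) v : (p v \in img k) = (v \in val k + U)%VS.
Proof. by rewrite in_set rp_mem ?addvSr. Qed.

Lemma card_img (k : I) : #|img k| = Q.
Proof.
transitivity #|val k|; last by rewrite card_vspace_rV egg_dim.
have <- : #|[set p v | v in val k]| = #|val k|.
  rewrite card_in_imset // => v w vk wk E0; apply/eqP; rewrite -subr_eq0 -memv0.
  rewrite -(egg_cap2 (IE k) UE (IU k)) memv_cap rpredB //=.
  rewrite -(rp_mem _ (subvv U)) linearB E0 subrr linear0; exact: mem0v.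
by apply: eq_card => x; apply/imgP/imsetP => -[v vk ->]; exists v.
Qed.

Lemma lineE (i j : I) x : (x \in line img i j) = (r x \in val i + val j + U)%VS.
Proof.
apply/lineP/idP => [[y]|].
  rewrite !in_set linearB => yj xy; rewrite -[r x](subrK (r y)) memvD //.
    by apply: subvP xy; rewrite addvAC addvSl.
  by apply: subvP yj; rewrite -addvA addvSr.
rewrite addvAC => /memv_addP[w wi [b bj xE]]; exists (p b).
  by rewrite mem_img (subvP (addvSl _ _)).
by rewrite -[x]rK xE -linearB addrK mem_img.
Qed.

Lemma line_imgE (i j k : I) :
  (img k \subset line img i j) = (val k <= val i + val j + U)%VS.
Proof.
have Usub : (U <= val i + val j + U)%VS by apply: addvSr.
apply/subsetP/subvP => [h v vk|h x].
  rewrite -(rp_mem _ Usub) -lineE; apply: h.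
  by rewrite mem_img (subvP (addvSl _ _)).
rewrite in_set lineE; apply: subvP; rewrite subv_add Usub andbT.
exact/subvP.
Qed.

Lemma card_I : #|{: I}| = (Q ^ 2)%N.
Proof.
rewrite -cardfE; have := cardfsD1 U E; rewrite card_egg UE; lia.
Qed.

Lemma card_X : #|{: 'rV[F]_(\dim U^C)}| = (Q ^ 3)%N.
Proof.
rewrite card_mx mul1n dimv_compl (egg_dim UE) dimvf /dim /= mul1n -expnM.
by congr expn; lia.
Qed.

Lemma img_disj (i j : I) x : x \in img i -> x \in img j -> x != 0 -> i = j.
Proof.
move=> /imgP[v vi ->]; rewrite mem_img => vj pv; apply/eqP.
apply: contraNT pv => ij.
have cap0 := egg_cap (IE i) (IE j) UE (neq_val ij) (IU i) (IU j).
have : v \in (val i :&: (val j + U))%VS by rewrite memv_cap vi.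
by rewrite cap0 memv0 => /eqP ->; rewrite linear0.
Qed.

(** Goodness at [U] applies to the 3n-space spanned by [U] and the two elements: it contains Q + 1
    elements of [E], one of which is [U] itself. *)
Lemma card_img_line (i j : I) : i != j ->
  #|[set k | img k \subset line img i j]| = Q.
Proof.
move=> ij; pose W := (val i + val j + U)%VS.
have dimW : \dim W = (3 * n)%N.
  exact: (egg_dim3 (IE i) (IE j) UE (neq_val ij) (IU i) (IU j)).
have sub k : k \in [set i; j] -> (val k <= W)%VS.
  by case/set2P=> ->; rewrite /W -?addvA ?addvSl // addvA addvAC addvSr.
have subU : (U <= W)%VS by apply: addvSr.
pose A0 := [fset A in E | (A <= W)%VS]%fset.
pose A1 := [fset A in E | (A != U) && (A <= W)%VS]%fset.
have A01 : #|` A0| = (#|` A1|).+1.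
  rewrite (cardfsD1 U) !inE UE subU add1n; congr (#|` _|).+1.
  by apply/fsetP => A; rewrite !inE /=; case: (A != U); rewrite ?andbF.
have cardA1 : #|` A1| = #|[set k | img k \subset line img i j]|.
  rewrite -(@card_fsub _ I A1).
    apply: eq_card => k; rewrite in_fsub [RHS]in_set line_imgE.
    by rewrite !inE /= IE IU.
  apply/fsubsetP => A; rewrite in_fsetD1 !inE => /andP[AE /andP[AU _]].
  by apply/andP; split.
have [_ /(_ W dimW subU)] := goodU; rewrite -/A0 -/A1 cardA1.
have A1_ge2 : (2 <= #|[set k | img k \subset line img i j]|)%N.
  apply: (@leq_trans #|[set i; j]|); first by rewrite cards2 ij.
  by apply/subset_leq_card/subsetP => k kij; rewrite in_set line_imgE sub.
by move=> /(_ A1_ge2); rewrite A01 cardA1; lia.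
Qed.

Lemma img0 k : 0 \in img k.
Proof. by rewrite in_set linear0 mem0v. Qed.

Lemma imgB k x y : x \in img k -> y \in img k -> x - y \in img k.
Proof. by rewrite !in_set linearB; apply: rpredB. Qed.

Definition img_homology := homology_ex Q_gt1 card_X card_I card_img img0 imgB
  img_disj card_img_line.
Definition img_through := through_ex Q_gt1 card_X card_I card_img img0 imgB
  img_disj card_img_line.
Definition img_indep := line_indep Q_gt1 card_X card_I card_img img0 imgB
  img_disj card_img_line.

End Quotient.

Lemma good_cover U A v : good_at n E U -> A \in E -> A != U ->
  exists T, [/\ T \in E, T != U, T != A & v \in (T + A + U)%VS].
Proof.
move=> goodU AE AU; have [p [r [rK rpU pU]]] := quotient_map U.
have AI : A \in (E `\ U)%fset by rewrite in_fsetD1 AU.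
have [k kA] := img_through goodU rK rpU pU (FSetSub AI) (p v).
rewrite (lineE rK rpU) rp_mem ?addvSr // => vk.
have := fsvalP k; rewrite in_fsetD1 => /andP[kU kE].
have kA' : val k != A.
  by apply: contraNneq kA => E1; apply/eqP/val_inj.
by exists (val k); rewrite [(val k + A)%VS]addvC.
Qed.

Lemma good_indep U A B C v : good_at n E U -> A \in E -> B \in E -> C \in E ->
  A != U -> B != U -> C != U -> A != B -> v \in C -> v \in (A + B + U)%VS ->
  v != 0 -> (C <= A + B + U)%VS.
Proof.
move=> goodU AE BE CE AU BU CU AB vC vAB v0.
have [p [r [rK rpU pU]]] := quotient_map U.
have AI : A \in (E `\ U)%fset by rewrite in_fsetD1 AU.
have BI : B \in (E `\ U)%fset by rewrite in_fsetD1 BU.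
have CI : C \in (E `\ U)%fset by rewrite in_fsetD1 CU.
have ij : FSetSub AI != FSetSub BI by rewrite -(inj_eq val_inj).
have := @img_indep _ goodU _ _ rK rpU pU _ _ (FSetSub CI) (p v) ij.
rewrite (line_imgE rK rpU) (lineE rK rpU) (mem_img rpU) (rp_mem rpU) ?addvSr //; apply=> //.
  by rewrite (subvP (addvSl _ _)).
apply: contraNneq v0 => pv0; rewrite -memv0 -(egg_cap2 CE (proj1 goodU) CU).
by rewrite memv_cap vC /= -(rp_mem rpU _ (subvv U)) pv0 linear0 mem0v.
Qed.

(** [homology_ex] lifted to [V] through [p] and [r]; the lift controls everything only modulo
    [U]. *)
Lemma good_homology U A s s' : good_at n E U -> A \in E -> A != U ->
  s \in A -> s' \in A -> s != 0 ->
  exists phi : V -> V, [/\ {morph phi : x y / x + y},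
    forall T v, T \in E -> v \in (T + U)%VS -> phi v \in (T + U)%VS
    & phi s - s' \in U].
Proof.
move=> goodU AE AU sA s'A s0; have [p [r [rK rpU pU]]] := quotient_map U.
have AI : A \in (E `\ U)%fset by rewrite in_fsetD1 AU.
have := @img_homology _ goodU _ _ rK rpU pU (FSetSub AI) (p s) (p s').
have AUP := subvP (addvSl A U).
rewrite !(mem_img rpU) (AUP _ sA) (AUP _ s'A).
have ps0 : p s != 0.
  apply: contraNneq s0 => ps0; rewrite -memv0 -(egg_cap2 AE (proj1 goodU) AU).
  by rewrite memv_cap sA /= -(rp_mem rpU _ (subvv U)) ps0 linear0 mem0v.
move=> /(_ isT ps0 isT)[phi [phiD phiS phis]].
exists (fun v => r (phi (p v))); split=> [x y|T v TE vT|].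
- by rewrite linearD phiD linearD.
- have phi0 : phi 0 = 0 by apply: (addIr (phi 0)); rewrite -phiD !add0r.
  have [TU|TU] := eqVneq T U.
    have vU : v \in U by move: vT; rewrite TU addvv.
    by rewrite pU // phi0 linear0 mem0v.
  have TI : T \in (E `\ U)%fset by rewrite in_fsetD1 TU.
  have := phiS (FSetSub TI) (p v); rewrite (mem_img rpU) => /(_ vT).
  by rewrite in_set.
- by rewrite phis -opprB rpredN rpU.
Qed.

Lemma egg_out3 A B D : A \in E -> B \in E -> D \in E ->
  A != B -> A != D -> B != D -> exists v, v \notin (A + B + D)%VS.
Proof.
move=> AE BE DE AB AD BD.
have /subvPn[v _ vABD] : ~~ (fullv <= A + B + D)%VS; last by exists v.
apply/negP => /dimvS; rewrite egg_dim3 // dimvf /dim /=.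
by move: n_gt0; clear; lia.
Qed.

(** An instance of [spread_kernel]: the spaces [T + A + U] cover [V] by [good_cover], and by
    [good_indep] two different ones meet only in [A + U]. *)
Lemma egg_kernel U A psi s : good_at n E U -> A \in E -> A != U ->
  {morph psi : x y / x + y} ->
  (forall T v, T \in E -> v \in (T + A + U)%VS -> psi v \in (T + A + U)%VS) ->
  s \notin (A + U)%VS -> psi s \in (A + U)%VS ->
  forall v, psi v \in (A + U)%VS.
Proof.
move=> goodU AE AU psiD psiE sAU psisAU; have UE := proj1 goodU.
pose J := (E `\ U `\ A)%fset; pose G (k : J) := (val k + A + U)%VS.
have JE (k : J) : [/\ val k \in E, val k != U & val k != A].
  by have := fsvalP k; rewrite !in_fsetD1 => /and3P[-> -> ->].
have AUG k : (A + U <= G k)%VS by rewrite /G -addvA addvSr.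
apply: (@spread_kernel V J (fun k => mem (G k)) (mem (A + U)%VS) psi s) => //.
- by move=> k; split=> [|x y]; [apply: mem0v | apply: rpredB].
- by split=> [|x y]; [apply: mem0v | apply: rpredB].
- by move=> k; apply/subvP.
- move=> v; have [T [TE TU TA vT]] := good_cover v goodU AE AU.
  have TJ : T \in J by rewrite !in_fsetD1 TU TA.
  by exists (FSetSub TJ).
- move=> j k v vj vk vAU; have [jE jU jA] := JE j; have [kE kU kA] := JE k.
  have [t tj [b bAU vE]] : exists2 t, t \in val j & exists2 b, b \in (A + U)%VS & v = t + b.
    move: vj; rewrite /G -addvA => /memv_addP[t tj [b bAU ->]].
    by exists t => //; exists b.
  have tk : t \in G k.
    by rewrite -(addrK b t) -vE rpredB // (subvP (AUG k)).
  have t0 : t != 0 by apply: contraNneq vAU => t0; rewrite vE t0 add0r.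
  have sub := good_indep goodU kE AE jE kU AU jU kA tj tk t0.
  by apply/subvP; rewrite /G -addvA subv_add sub AUG.
- move=> k; have [kE kU kA] := JE k; exact: egg_out3.
- by move=> k v; have [kE _ _] := JE k; apply: psiE.
Qed.

Definition preserver (phi : V -> V) :=
  {morph phi : x y / x + y} /\ forall T v, T \in E -> v \in T -> phi v \in T.

(** * Additive maps preserving an egg with two good elements *)

Section TwoGood.

Variables (U W : {vspace V}).
Hypotheses (goodU : good_at n E U) (goodW : good_at n E W) (UW : U != W).

Let UE : U \in E := proj1 goodU.
Let WE : W \in E := proj1 goodW.
Let WU : W != U. Proof. by rewrite eq_sym. Qed.

(* The maps [phi1] modulo [U] and [phi2] modulo [W] differ by values in [U + W];
   subtracting the [U]-component of the difference from [phi1] glues them. *)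
Lemma preserver_ex A s s' : A \in E -> A != U -> A != W ->
  s \in A -> s' \in A -> s != 0 -> exists2 phi, preserver phi & phi s = s'.
Proof.
move=> AE AU AW sA s'A s0.
have [phi1 [phi1D phi1E phi1s]] := good_homology goodU AE AU sA s'A s0.
have [phi2 [phi2D phi2E phi2s]] := good_homology goodW AE AW sA s'A s0.
pose del v := phi1 v - phi2 v.
have delD : {morph del : x y / x + y}.
  by move=> x y; rewrite /del phi1D phi2D opprD addrACA.
have mem_add phi B C : {morph phi : x y / x + y} ->
    (forall T w, T \in E -> w \in (T + B)%VS -> phi w \in (T + B)%VS) ->
    C \in E -> forall T v, T \in E ->
    v \in (T + C + B)%VS -> phi v \in (T + C + B)%VS.
  move=> phiD phiE CE T v TE /memv_addP[_ /memv_addP[t tT [c cC ->]] [b bB ->]].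
  have TB : (T + B <= T + C + B)%VS by rewrite addvAC addvSl.
  have CB : (C + B <= T + C + B)%VS by rewrite -addvA addvSr.
  rewrite !phiD -addrA memvD ?memvD //.
  - apply: (subvP TB); apply: phiE => //; exact: subvP (addvSl _ _) _ tT.
  - apply: (subvP CB); apply: phiE => //; exact: subvP (addvSl _ _) _ cC.
  - apply: (subvP CB); apply: phiE => //; exact: subvP (addvSr _ _) _ bB.
(* Both maps preserve all spaces [T + W + U] and agree at [s] modulo [W + U], while [s] is outside
   [W + U]; so [egg_kernel] applies to their difference. *)
have del_out v : del v \in (W + U)%VS.
  apply: (egg_kernel goodU WE WU delD (s := s)).
  - move=> T w TE wT; apply: rpredB; first exact: (mem_add phi1).
    by rewrite addvAC (mem_add phi2) // addvAC.
  - apply: contra s0 => sWU; rewrite -memv0 -(egg_cap AE WE UE AW AU WU).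
    by rewrite memv_cap sA.
  - have -> : del s = (s' - phi2 s) + (phi1 s - s') by rewrite addrC addrA subrK.
    by apply: memv_add; rewrite // -opprB rpredN.
have capUW := egg_cap2 UE WE UW.
have delU v : del v \in (U + W)%VS by rewrite addvC.
pose phi v := phi1 v - daddv_pi U W (del v).
have phiU v : phi v - phi1 v \in U by rewrite /phi addrC addKr rpredN memv_pi.
have phiW v : phi v - phi2 v \in W.
  have -> : phi v - phi2 v = daddv_pi W U (del v); last exact: memv_pi.
  by rewrite /phi addrAC -/(del v) -{1}(daddv_pi_add capUW (delU v)) addrC addKr.
have memU T v : T \in E -> v \in T -> phi v \in (T + U)%VS.
  move=> TE vT; rewrite -[phi v](subrK (phi1 v)) addrC memvD //.
    by apply: phi1E => //; apply: subvP (addvSl _ _) _ vT.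
  exact: subvP (addvSr _ _) _ (phiU v).
have memW T v : T \in E -> v \in T -> phi v \in (T + W)%VS.
  move=> TE vT; rewrite -[phi v](subrK (phi2 v)) addrC memvD //.
    by apply: phi2E => //; apply: subvP (addvSl _ _) _ vT.
  exact: subvP (addvSr _ _) _ (phiW v).
exists phi; first split=> [x y|T v TE vT].
- by rewrite /phi phi1D delD linearD opprD addrACA.
- have [TU|TU] := eqVneq T U; first by have := memU T v TE vT; rewrite TU addvv.
  have [TW|TW] := eqVneq T W; first by have := memW T v TE vT; rewrite TW addvv.
  (* [T + U] and [T + W] have only [T] in common, because [T] meets [U + W] trivially and [U] meets
     [W] trivially. *)
  have /memv_addP[t tT [u uU E1]] := memU T v TE vT.
  have /memv_addP[t' t'T [w wW E2]] := memW T v TE vT.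
  have tt' : t - t' \in (T :&: (U + W))%VS.
    rewrite memv_cap rpredB //=; have -> : t - t' = - u + w.
      by rewrite -[t](addrK u) -E1 E2 addrAC [t' + w]addrC addrK addrC.
    by apply: memv_add; rewrite ?rpredN.
  move: tt'; rewrite (egg_cap TE UE WE TU TW UW) memv0 subr_eq0 => /eqP tt'.
  have uw : u = w by apply: (addrI t); rewrite -E1 E2 tt'.
  have : u \in (U :&: W)%VS by rewrite memv_cap uU uw.
  by rewrite capUW memv0 E1 => /eqP ->; rewrite addr0.
(* [phi s - s'] lies in [U] by comparison with [phi1], and in [W] by comparison with [phi2]. *)
- apply/eqP; rewrite -subr_eq0 -memv0 -capUW memv_cap.
  apply/andP; split.
    by rewrite -(subrK (phi1 s) (phi s)) -addrA memvD.
  by rewrite -(subrK (phi2 s) (phi s)) -addrA memvD.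
Qed.

(** As [phi] kills [c], which is outside [B + X], its whole image lies in [B + X] by [egg_kernel].
    Hence [phi d] is in the intersection of [D] with [B + X], which is zero. *)
Lemma preserver_kills phi X B C D c d : preserver phi -> good_at n E X ->
  B \in E -> C \in E -> D \in E -> B != X -> C != X -> C != B -> D != X -> D != B ->
  c \in C -> c != 0 -> phi c = 0 -> d \in D -> phi d = 0.
Proof.
move=> [phiD phiE] goodX BE CE DE BX CX CB DX DB cC c0 phic dD.
have XE := proj1 goodX; apply/eqP; rewrite -memv0.
rewrite -(egg_cap DE BE XE DB DX BX) memv_cap (phiE _ _ DE dD) /=.
apply: (egg_kernel goodX BE BX phiD (s := c)) => [T v TE||].
- case/memv_addP=> _ /memv_addP[t tT [b bB ->]] [x xX ->].
  by rewrite !phiD; apply: memv_add; [apply: memv_add|]; apply: phiE.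
- apply: contra c0 => cBX; rewrite -memv0 -(egg_cap CE BE XE CB CX BX).
  by rewrite memv_cap cC.
- by rewrite phic mem0v.
Qed.

Lemma egg_nz A : A \in E -> vpick A != 0.
Proof.
by move=> AE; rewrite vpick0 -dimv_eq0 egg_dim // -lt0n.
Qed.

(** [preserver_kills] with [X = U] and [B = W] reaches all elements but [U] and [W]. These two are
    reached from another element [T], with [B = A] and the other good element as [X]. By
    [good_cover] the killed elements span [V]. *)
Lemma preserver_eq0 phi A s : preserver phi -> A \in E -> A != U -> A != W ->
  s \in A -> s != 0 -> phi s = 0 -> forall v, phi v = 0.
Proof.
move=> phiP AE AU AW sA s0 phis v; have [phiD phiE] := phiP.
have [T [TE TU TW TA]] := egg_fourth U W A.
have UA : U != A by rewrite eq_sym.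
have WA : W != A by rewrite eq_sym.
have kill D d : D \in E -> D != U -> D != W -> d \in D -> phi d = 0.
  by move=> DE DU DW; apply: (preserver_kills phiP goodU WE AE DE WU AU AW DU DW sA s0).
have phit := kill T (vpick T) TE TU TW (memv_pick T).
have killU d : d \in U -> phi d = 0.
  apply: (preserver_kills phiP goodW AE TE UE AW TW TA UW UA (memv_pick T)) => //.
  exact: egg_nz.
have killW d : d \in W -> phi d = 0.
  apply: (preserver_kills phiP goodU AE TE WE AU TU TA WU WA (memv_pick T)) => //.
  exact: egg_nz.
have [D [DE DU DW]] := good_cover v goodU WE WU.
case/memv_addP=> _ /memv_addP[d dD [w wW ->]] [u uU ->].
by rewrite !phiD (kill D d) // (killU u) // (killW w) // !addr0.
Qed.

Lemma preserver_inj phi psi A s : preserver phi -> preserver psi ->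
  A \in E -> A != U -> A != W -> s \in A -> s != 0 -> phi s = psi s ->
  phi =1 psi.
Proof.
move=> [phiD phiE] [psiD psiE] AE AU AW sA s0 E1 v; apply/eqP; rewrite -subr_eq0.
apply/eqP; apply: (@preserver_eq0 (fun x => phi x - psi x) A s) => //.
  split=> [x y|T x TE xT]; first by rewrite phiD psiD opprD addrACA.
  by rewrite rpredB ?phiE ?psiE.
by rewrite E1 subrr.
Qed.

(** Evaluation at [s] is a bijection from the preservers to [A]: onto by [preserver_ex], injective
    by [preserver_inj]. Through the coordinates [e] of [A], composition becomes a multiplication on
    row vectors, and each algebraic law need only be checked at [s]. *)
Lemma egg_action : exists (L : fieldExtType F) (act : L -> V -> V),
  [/\ \dim {:L} = n, forall c, preserver (act c),
      forall c d v, act (c + d) v = act c v + act d v,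
      forall c d v, act (c * d) v = act c (act d v)
    & forall a v, act a%:A v = a *: v].
Proof.
have [A [AE AU AW _]] := egg_fourth U W W.
have [e [e_inj eA]] := vspace_param (egg_dim AE).
pose s := vpick A; have sA : s \in A by apply: memv_pick.
have s0 : s != 0 by apply: egg_nz.
have eA' x : e x \in A by apply/eA; exists x.
have [act actP] : exists act : 'rV[F]_n -> V -> V,
    forall x, preserver (act x) /\ act x s = e x.
  apply: (@fin_all_exists _ (fun=> V -> V)
    (fun x phi => preserver phi /\ phi s = e x)) => x.
  by have [phi phiP phis] := preserver_ex AE AU AW sA (eA' x) s0; exists phi.
have actI x (psi : V -> V) : preserver psi -> e x = psi s -> act x =1 psi.
  move=> psiP E1; have [xP xs] := actP x.
  by apply: (preserver_inj xP psiP AE AU AW sA s0); rewrite xs.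
have actD x y v : act (x + y) v = act x v + act y v.
  have [[aD aE] as_] := actP x; have [[bD bE] bs] := actP y.
  apply: (actI _ (fun v => act x v + act y v)); last by rewrite as_ bs linearD.
  split=> [u w|T u TE uT]; first by rewrite aD bD addrACA.
  by rewrite rpredD ?aE ?bE.
have actZ c x v : act (c *: x) v = c *: act x v.
  have [[aD aE] as_] := actP x.
  apply: (actI _ (fun v => c *: act x v)); last by rewrite as_ linearZ.
  split=> [u w|T u TE uT]; first by rewrite aD scalerDr.
  by rewrite memvZ ?aE.
pose einv v := odflt 0 [pick x | e x == v].
have einvK v : v \in A -> e (einv v) = v.
  case/eA=> x ->; rewrite /einv; case: pickP => [y /eqP //|/(_ x)].
  by rewrite eqxx.
(* As [e y] is [act y s], this is the label of the composite of [act x] and [act y]; likewise [one]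
   labels the identity. *)
pose mul x y := einv (act x (e y)); pose one := einv s.
have eM x y : e (mul x y) = act x (e y).
  by rewrite einvK //; have [[_ aE] _] := actP x; apply: aE.
have actM x y v : act (mul x y) v = act x (act y v).
  have [[aD aE] as_] := actP x; have [[bD bE] bs] := actP y.
  apply: (actI _ (fun v => act x (act y v))); last by rewrite bs eM.
  split=> [u w|T u TE uT]; first by rewrite bD aD.
  exact/aE/bE.
have act1 v : act one v = v.
  by apply: (actI _ id); rewrite ?einvK.
have mulA : associative mul by move=> x y z; apply: e_inj; rewrite !eM actM.
have mul1x : left_id one mul by move=> x; apply: e_inj; rewrite eM act1.
have mulx1 : right_id one mul.
  by move=> x; apply: e_inj; rewrite eM einvK // (proj2 (actP _)).
have mulDl : left_distributive mul +%R.
  by move=> x y z; apply: e_inj; rewrite linearD !eM actD.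
have mulDr : right_distributive mul +%R.
  move=> x y z; apply: e_inj; rewrite linearD !eM linearD.
  by have [[aD _] _] := actP x; rewrite aD.
have mulZl c x y : mul (c *: x) y = c *: mul x y.
  by apply: e_inj; rewrite linearZ !eM actZ.
have one0 : one != 0.
  by apply: contraNneq s0 => one0; rewrite -(einvK _ sA) -/one one0 linear0.
have mul_dom x y : mul x y = 0 -> x = 0 \/ y = 0.
  move=> /(congr1 e); rewrite eM linear0 => xy0.
  have [->|y0] := eqVneq y 0; [by right | left; apply: (e_inj)].
  have ey0 : e y != 0 by rewrite -(linear0 e) (inj_eq e_inj).
  have [xP xs] := actP x; rewrite linear0 -xs.
  exact: (preserver_eq0 xP AE AU AW (eA' y) ey0 xy0).
have [L [h [dimL [h' hK h'K] hM]]] :=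
  fieldExt_of_mul mulA mul1x mulx1 mulDl mulDr mulZl one0 mul_dom.
(* [h] is known to be linear and multiplicative; [h one] is a nonzero idempotent of a field. *)
have h1 : h one = 1.
  have h10 : h one != 0 by rewrite -(linear0 h) (inj_eq (can_inj hK)).
  by apply: (mulfI h10); rewrite -hM mul1x mulr1.
exists L, (fun c => act (h' c)); split.
- exact: dimL.
- by move=> c; have [] := actP (h' c).
- by move=> c d v; rewrite -actD; congr act; apply: (can_inj hK); rewrite linearD !h'K.
- by move=> c d v; rewrite -actM; congr act; apply: (can_inj hK); rewrite hM !h'K.
- move=> a v; rewrite -{2}(act1 v) -actZ; congr act; apply: (can_inj hK).
  by rewrite h'K linearZ /= h1.
Qed.

End TwoGood.

(** * Coordinates over [L] *)

(** A vector outside [A + W + U] lies in some [T + W + U], so [T] is not contained in [A + W + U],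
    and by [good_indep] it meets that space trivially. The four elements then provide a basis over
    [L]. *)
Lemma egg_frame U W : good_at n E U -> W \in E -> W != U ->
  exists A T, [/\ A \in E, T \in E, A != U, A != W & (T :&: (A + W + U) = 0)%VS].
Proof.
move=> goodU WE WU; have UE := proj1 goodU.
have [A [AE AU AW _]] := egg_fourth U W W.
have [v vAWU] := egg_out3 AE WE UE AW AU WU.
have [T [TE TU TW vT]] := good_cover v goodU WE WU.
exists A, T; split=> //; apply/eqP; rewrite -subv0; apply/subvP => x.
rewrite memv_cap memv0 => /andP[xT xAWU]; apply: contraNT vAWU => x0.
have sub := good_indep goodU AE WE TE AU WU TU AW xT xAWU x0.
apply: subvP vT; rewrite -addvA subv_add sub -addvA; exact: addvSr.
Qed.

(** One nonzero vector from each of [A], [B], [C], [D] gives an [L]-basis of [V], whose coordinate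
    map is the identification [f]. Every element of [E] is a single [L]-line, and the cap condition
    is inherited from [egg_cap]. *)
Lemma elementary_of_action (L : fieldExtType F) (act : L -> V -> V) A B C D :
  \dim {:L} = n -> (forall c, preserver (act c)) ->
  (forall c d v, act (c + d) v = act c v + act d v) ->
  (forall c d v, act (c * d) v = act c (act d v)) ->
  (forall a v, act a%:A v = a *: v) ->
  A \in E -> B \in E -> C \in E -> D \in E ->
  (A :&: (B + C + D) = 0)%VS -> (B :&: (C + D) = 0)%VS -> (C :&: D = 0)%VS ->
  elementary 4 n E.
Proof.
move=> dimL actP actD actM actZ AE BE CE DE capA capB capC.
have actDr c u v : act c (u + v) = act c u + act c v.
  by case: (actP c) => aD _; apply: aD.
have actE c T v : T \in E -> v \in T -> act c v \in T.
  by case: (actP c) => _ aE; apply: aE.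
have act1 v : act 1 v = v by rewrite -[1]scale1r actZ scale1r.
have act0 v : act 0 v = 0 by rewrite -(scale0r 1) actZ scale0r.
have actr0 c : act c 0 = 0 by apply: (addIr (act c 0)); rewrite -actDr !add0r.
have act_sum c (I : finType) (u : I -> V) : act c (\sum_i u i) = \sum_i act c (u i).
  by apply: (big_morph (act c)) => // x y; apply: actDr.
have act_eq0 c v : v != 0 -> act c v = 0 -> c = 0.
  move=> v0 cv; apply/eqP; apply: contraNT v0 => c0.
  by rewrite -[v]act1 -(mulVf c0) actM cv actr0.
pose M (i : 'I_4) := nth A [:: A; B; C; D] i.
pose g (c : 'rV[L]_4) : V := \sum_i act (c 0 i) (vpick (M i)).
have gD c d : g (c + d) = g c + g d.
  by rewrite /g -big_split; apply: eq_bigr => i _ /=; rewrite mxE actD.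
have gZ k c : g (k *: c) = act k (g c).
  by rewrite /g act_sum; apply: eq_bigr => i _; rewrite mxE actM.
have g_eq0 c : g c = 0 -> c = 0.
  rewrite /g !big_ord_recl big_ord0 addr0 /M /=.
  set a := act _ _; set b := act _ (vpick B); set d := act _ (vpick C).
  set w := act _ (vpick D) => E0.
  have [aA bB] : a \in A /\ b \in B by split; apply/actE/memv_pick.
  have [dC wD] : d \in C /\ w \in D by split; apply/actE/memv_pick.
  have a0 : a = 0.
    apply/eqP; rewrite -memv0 -capA memv_cap aA /= -addvA.
    have -> : a = - (b + (d + w)) by apply/eqP; rewrite -addr_eq0 E0.
    by rewrite rpredN !memv_add.
  rewrite a0 add0r in E0.
  have b0 : b = 0.
    apply/eqP; rewrite -memv0 -capB memv_cap bB /=.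
    have -> : b = - (d + w) by apply/eqP; rewrite -addr_eq0 E0.
    by rewrite rpredN !memv_add.
  rewrite b0 add0r in E0.
  have d0 : d = 0.
    apply/eqP; rewrite -memv0 -capC memv_cap dC /=.
    have -> : d = - w by apply/eqP; rewrite -addr_eq0 E0.
    by rewrite rpredN.
  rewrite d0 add0r in E0.
  have c0 := act_eq0 _ _ (egg_nz AE) a0; have c1 := act_eq0 _ _ (egg_nz BE) b0.
  have c2 := act_eq0 _ _ (egg_nz CE) d0; have c3 := act_eq0 _ _ (egg_nz DE) E0.
  apply/rowP => -[[|[|[|[|//]]]] ilt]; rewrite mxE;
    [apply: etrans c0|apply: etrans c1|apply: etrans c2|apply: etrans c3];
    by congr (c 0 _); apply: val_inj.
have gN c : g (- c) = - g c.
  by apply/eqP; rewrite -addr_eq0 -gD addNr /g big1 // => i _; rewrite mxE act0.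
have g_inj : injective g.
  move=> c d E0; apply/eqP; rewrite -subr_eq0; apply/eqP/g_eq0.
  by rewrite gD gN E0 subrr.
have [e [e_inj eL]] := vspace_param dimL.
have eK x : exists y, x = e y by apply/eL; apply: memvf.
(* [L] enters through its coordinates [e] over [F], which makes [g] an injection between two finite
   sets of q^(4n) elements. *)
have g_surj v : exists c, g c = v.
  pose G (y : {ffun 'I_4 -> 'rV[F]_n}) := g (\row_i e (y i)).
  have G_inj : injective G.
    move=> y z /g_inj/rowP yz; apply/ffunP => i; apply: e_inj.
    by have := yz i; rewrite !mxE.
  have [|G' _ G'K] := inj_card_bij G_inj.
    by rewrite card_ffun card_ord !card_mx !mul1n -expnM mulnC.
  by exists (\row_i e (G' v i)); apply: G'K.
have [f fK] : exists f : V -> 'rV[L]_4, cancel f g.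
  exact: (@fin_all_exists _ (fun=> 'rV[L]_4) (fun v c => g c = v)).
have gK : cancel g f by move=> c; apply: g_inj; rewrite fK.
have fact c v : f (act c v) = c *: f v by apply: g_inj; rewrite gZ !fK.
have fD u v : f (u + v) = f u + f v by apply: g_inj; rewrite gD !fK.
have f_lin : scalable_for (in_alg L \; *:%R) f.
  by move=> a v; rewrite -actZ fact.
have f_add : {morph f : x y / x + y} := fD.
pose fA := GRing.isSemilinear.Build _ _ _ _ f (conj f_lin f_add).
pose fL : {linear V -> 'rV[L]_4 | in_alg L \; *:%R} := HB.pack f fA.
have f_eq0 v : v != 0 -> f v != 0.
  by apply: contraNneq => fv; rewrite -(fK v) fv -(gK 0) fK -(subrr (f 0)) gD gN subrr.
have act_inj v : v != 0 -> injective (act^~ v).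
  move=> v0 c d E0; apply/eqP; rewrite -subr_eq0; apply/eqP/(act_eq0 _ v v0).
  by apply: (addIr (act d v)); rewrite -actD subrK add0r.
(* The [L]-multiples of [t] all lie in [T] and number q^n, which is the size of [T]. *)
have act_surj T t v : T \in E -> t \in T -> t != 0 -> v \in T ->
    exists c, v = act c t.
  move=> TE tT t0 vT.
  have sub : [set act (e y) t | y in [set: 'rV[F]_n]] \subset T.
    by apply/subsetP => _ /imsetP[y _ ->]; apply: actE.
  have cardT : #|[set act (e y) t | y in [set: 'rV[F]_n]]| = #|T|.
    rewrite card_imset ?cardsT ?card_mx ?card_vspace_rV ?mul1n ?egg_dim //.
    by move=> y z /(act_inj _ t0)/e_inj.
  have /subset_cardP/(_ sub v) := cardT; rewrite vT => /imsetP[y _ ->].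
  by exists (e y).
pose P (A : {vspace V}) := <[f (vpick A)]>%VS.
have PE T v : T \in E -> (v \in T) = (f v \in P T).
  move=> TE; apply/idP/vlineP => [vT|[c]].
    have [c ->] := act_surj T (vpick T) v TE (memv_pick T) (egg_nz TE) vT.
    by exists c; rewrite fact.
  rewrite -fact => /(can_inj fK) ->.
  exact/actE/memv_pick.
have gP T x : T \in E -> (x \in P T) = (g x \in T) by move=> TE; rewrite PE // gK.
have capP T T' : T \in E -> T' \in E -> T != T' -> (P T :&: P T' = 0)%VS.
  move=> TE T'E TT'; apply/eqP; rewrite -subv0; apply/subvP => x.
  rewrite memv_cap !gP // => /andP[xT xT'].
  have : g x \in (T :&: T')%VS by rewrite memv_cap xT.
  rewrite (egg_cap2 TE T'E TT') [g x \in _]memv0 => /eqP gx0.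
  by rewrite (g_eq0 x gx0); apply: mem0v.
exists L, fL, [fset P T | T in E]%fset; split=> //.
- by exists g.
- split=> [_ /imfsetP[T /= TE ->]|].
    by rewrite dim_vline f_eq0 ?egg_nz.
  move=> _ _ _ /imfsetP[T1 /= E1 ->] /imfsetP[T2 /= E2 ->] /imfsetP[T3 /= E3 ->].
  rewrite !inE negb_or andbT => /andP[/andP[P12 P13] P23].
  have neq T T' : P T != P T' -> T != T' by apply: contraNneq => ->.
  (* The first two points are independent, and the third meets their span trivially because [g]
     carries a common vector into [T3] and [T1 + T2]. *)
  rewrite dimv_disjoint_sum.
    by rewrite dimv_disjoint_sum ?capP ?neq // !dim_vline !f_eq0 ?egg_nz.
  apply/eqP; rewrite -subv0; apply/subvP => x; rewrite memv_cap.
  case/andP=> /memv_addP[y yT1 [z zT2 xE]] xT3.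
  have : g x \in (T3 :&: (T1 + T2))%VS.
    by rewrite memv_cap -gP // xT3 xE gD memv_add // -gP.
  rewrite (egg_cap E3 E1 E2) ?neq // 1?eq_sym //.
  by rewrite [g x \in _]memv0 => /eqP gx0; rewrite (g_eq0 x gx0); apply: mem0v.
move=> T; split=> [TE|[_ /imfsetP[T' /= T'E ->] h]].
  by exists (P T); [apply/imfsetP; exists T | move=> v; apply: PE].
suff -> : T = T' by [].
by apply/vspaceP => v; rewrite h -PE.
Qed.

End Egg.

Local Open Scope fset_scope.

Theorem corollary3p6 (F : finFieldType) (n : nat)
    (E : {fset {vspace 'rV[F]_(4 * n)}}) (E1 E2 : {vspace 'rV[F]_(4 * n)}) :
  (1 <= n)%N -> weak_egg n E -> E1 != E2 -> good_at n E E1 -> good_at n E E2 ->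
  elementary 4 n E.
Proof.
move=> n_gt0 eggE E12 good1 good2; have E1E := proj1 good1; have E2E := proj1 good2.
have E21 : E2 != E1 by rewrite eq_sym.
have [A [T [AE TE A1 A2 capT]]] := egg_frame n_gt0 eggE good1 E2E E21.
have [L [act [dimL actP actD actM actZ]]] := egg_action n_gt0 eggE good1 good2 E12.
apply: (elementary_of_action n_gt0 eggE dimL actP actD actM actZ TE AE E2E E1E capT).
  exact: (egg_cap n_gt0 eggE AE E2E E1E A2 A1 E21).
exact: (egg_cap2 n_gt0 eggE E2E E1E E21).
Qed.
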